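(* Let $\nu>0$ and $\alpha\in\mathbb{R}$. (i) For every $f\in\mathcal{F}^{2,\nu}_{\alpha}(\mathbb{C})$ and every $z\in\mathbb{C}$, $$|f(z)|\le \|f\|_{\nu}\left(\left(\frac{2\nu}{\pi}\right)^{1/2}e^{\frac{\nu}{2}(z^2+\overline{z}^2)}\,\theta_{\alpha,0}\!\left(z-\overline{z}\,\Big|\,\frac{2i\pi}{\nu}\right)\right)^{1/2}.$$ In particular, for every compact set $K\subset\mathbb{C}$ there exists a constant $C_K\ge 0$ such that $|f(z)|\le C_K\|f\|_{\nu}$ for all $z\in K$ and all $f\in\mathcal{F}^{2,\nu}_{\alpha}(\mathbb{C})$. (ii) $\mathcal{F}^{2,\nu}_{\alpha}(\mathbb{C})$, with the inner product $\langle\cdot,\cdot\rangle_\nu$, is a Hilbert space, and the functions $$\psi_n^{\alpha,\nu}(z):=\left(\frac{2\nu}{\pi}\right)^{1/4}e^{\frac{\nu}{2}z^2}\,e^{-\frac{\pi^2}{\nu}(n+\alpha)^2+2i\pi(\alpha+n)z},\qquad n\in\mathbb{Z},$$ form an orthonormal basis of it. (iii) $\mathcal{F}^{2,\nu}_{\alpha}(\mathbb{C})$ admits a reproducing kernel, given explicitly by $$K_{\alpha,\nu}(z,w)=\left(\frac{2\nu}{\pi}\right)^{1/2}e^{\frac{\nu}{2}(z^2+\overline{w}^2)}\,\theta_{\alpha,0}\!\left(z-\overline{w}\,\Big|\,\frac{2i\pi}{\nu}\right).$$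
   Context: Write $z=x+iy$ with $x,y\in\mathbb{R}$, let $d\lambda(z)=dx\,dy$ be Lebesgue measure on $\mathbb{C}$, and let $S=[0,1]\times\mathbb{R}=\{x+iy: 0\le x\le 1,\ y\in\mathbb{R}\}$. Let $\mathcal{O}^{\nu}_{\alpha}(\mathbb{C})$ be the space of entire functions $f$ satisfying $$f(z+m)=e^{2i\pi\alpha m}e^{\nu(z+\frac m2)m}f(z)\qquad\text{for all }z\in\mathbb{C},\ m\in\mathbb{Z}.$$ Set $\langle f_1,f_2\rangle_\nu=\int_S f_1(z)\overline{f_2(z)}e^{-\nu|z|^2}d\lambda(z)$ and $\|f\|_\nu^2=\int_S|f(z)|^2e^{-\nu|z|^2}d\lambda(z)$, and let $\mathcal{F}^{2,\nu}_{\alpha}(\mathbb{C})=\{f\in\mathcal{O}^{\nu}_{\alpha}(\mathbb{C}):\|f\|_\nu<+\infty\}$. For $\alpha,\beta\in\mathbb{R}$, $z\in\mathbb{C}$ and $\tau\in\mathbb{C}$ with $\Im(\tau)>0$, the Riemann (modified) theta function is $$\theta_{\alpha,\beta}(z|\tau)=\sum_{n\in\mathbb{Z}}e^{i\pi(n+\alpha)^2\tau+2i\pi(n+\alpha)(z+\beta)}.$$ *)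

(* Defs.v *)
From HB Require Import structures.
From mathcomp Require Import all_boot all_order all_algebra.
From mathcomp Require Import all_classical all_reals all_analysis.
From mathcomp Require Import complex.

Set Implicit Arguments.
Unset Strict Implicit.
Unset Printing Implicit Defensive.

Import Order.TTheory GRing.Theory Num.Theory.
Import numFieldNormedType.Exports.
Import Normc.

Local Open Scope classical_set_scope.
Local Open Scope ring_scope.
Local Open Scope complex_scope.

(* Hilbert spaces carried by a subset [H] of a complex vector space, with a   *)
(* form that is linear in its first argument.                                 *)
Section HilbertSpace.
Context {R : realType} {V : lmodType R[i]}.
Implicit Types (H : set V) (dot : V -> V -> R[i]).

Definition linear_subspace H : Prop :=
  H 0 /\ forall (a : R[i]) u v, H u -> H v -> H (a *: u + v).

Definition inner_product_on H dot : Prop :=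
  [/\ forall (a : R[i]) u v w, H u -> H v -> H w ->
        dot (a *: u + v) w = a * dot u w + dot v w,
      forall u v, H u -> H v -> dot v u = ((dot u v)^*)%C,
      forall u, H u -> 0 <= dot u u
    & forall u, H u -> dot u u = 0 -> u = 0].

Definition dot_norm dot (u : V) : R := Num.sqrt (complex.Re (dot u u)).

Definition dot_cauchy dot (u : nat -> V) : Prop :=
  forall e : R, 0 < e -> exists N : nat, forall m n : nat,
    (N <= m)%N -> (N <= n)%N -> dot_norm dot (u m - u n) < e.

Definition complete_on H dot : Prop :=
  forall u : nat -> V, (forall n, H (u n)) -> dot_cauchy dot u ->
    exists2 l, H l & (fun n => dot_norm dot (u n - l)) @ \oo --> (0 : R).

Definition hilbert_space H dot : Prop :=
  [/\ linear_subspace H, inner_product_on H dot & complete_on H dot].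

(* An orthonormal family in [H] whose finite linear combinations are dense.   *)
Definition orthonormal_basis (I : eqType) H dot (e : I -> V) : Prop :=
  [/\ forall i, H (e i),
      forall i j, dot (e i) (e j) = (i == j)%:R
    & forall u, H u -> forall eps : R, 0 < eps ->
        exists (s : seq I) (c : I -> R[i]),
          dot_norm dot (u - \sum_(i <- s) c i *: e i) < eps].

End HilbertSpace.

Definition reproducing_kernel (R : realType) (T : Type)
    (H : set (T -> R[i])) (dot : (T -> R[i]) -> (T -> R[i]) -> R[i])
    (K : T -> T -> R[i]) : Prop :=
  forall w, H (K^~ w) /\ forall f, H f -> f w = dot f (K^~ w).

Section ComplexAnalysis.
Context {R : realType}.

Definition cexp (z : R[i]) : R[i] :=
  (expR (complex.Re z))%:C * (cos (complex.Im z) +i* sin (complex.Im z)).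

(* [R[i]^o] is [R[i]] with the topology and normed-module structure over      *)
(* itself, so that [derivable] means complex differentiable.                  *)
Definition entire (f : R[i] -> R[i]) : Prop :=
  forall z : R[i], derivable (f : R[i]^o -> R[i]^o) z 1.

(* Sum over [int] of an absolutely convergent family: [Negz n] is [- n.+1].   *)
Definition zsum (u : int -> R[i]) : R[i] :=
  lim (series (fun n => u (Posz n) : R[i]^o) @ \oo)
  + lim (series (fun n => u (Negz n) : R[i]^o) @ \oo).

Definition theta (alpha beta : R) (z tau : R[i]) : R[i] :=
  zsum (fun n : int =>
    cexp ('i%C * pi%:C * (n%:~R + alpha%:C) ^+ 2 * tau
          + 2 * 'i%C * pi%:C * (n%:~R + alpha%:C) * (z + beta%:C))).

(* The Lebesgue measure dx dy and the strip S = [0, 1] x R, in the real       *)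
(* coordinates (x, y) of z = x + iy.                                          *)
Definition lebesgue2 :
    {measure set (measurableTypeR R * measurableTypeR R) -> \bar R} :=
  (lebesgue_measure \x lebesgue_measure)%E.

Definition strip : set (measurableTypeR R * measurableTypeR R) :=
  `[0, 1]%classic `*` setT.

Definition strip_integrable (f : R[i] -> R[i]) : Prop :=
  lebesgue2.-integrable strip (fun p => (complex.Re (f (p.1 +i* p.2)))%:E) /\
  lebesgue2.-integrable strip (fun p => (complex.Im (f (p.1 +i* p.2)))%:E).

Definition strip_integral (f : R[i] -> R[i]) : R[i] :=
  (\int[lebesgue2]_(p in strip) complex.Re (f (p.1 +i* p.2)))
  +i* (\int[lebesgue2]_(p in strip) complex.Im (f (p.1 +i* p.2))).

End ComplexAnalysis.

Section ThetaFock.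
Context {R : realType}.
Implicit Types (nu alpha : R) (f g : R[i] -> R[i]).

Definition gauss_weight nu (z : R[i]) : R := expR (- nu * normc z ^+ 2).

Definition fock_sqnorm nu f : \bar R :=
  (\int[lebesgue2]_(p in strip)
     (normc (f (p.1 +i* p.2)) ^+ 2 * gauss_weight nu (p.1 +i* p.2))%:E)%E.

Definition fock_norm nu f : R := Num.sqrt (fine (fock_sqnorm nu f)).

Definition fock_integrand nu f g (z : R[i]) : R[i] :=
  f z * ((g z)^*)%C * (gauss_weight nu z)%:C.

Definition fock_dot nu f g : R[i] := strip_integral (fock_integrand nu f g).

Lemma fock_norm_dot nu f : dot_norm (fock_dot nu) f = fock_norm nu f.
Proof.
rewrite /dot_norm /fock_norm /fock_sqnorm /fock_dot /strip_integral /=.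
congr (Num.sqrt (fine _)); apply: eq_integral => p _; congr (_%:E).
rewrite /fock_integrand; case: (f _) => a b /=.
by rewrite sqr_sqrtr ?addr_ge0 ?sqr_ge0 // mulr0 subr0 mulrN opprK -!expr2.
Qed.

Definition quasi_periodic nu alpha f : Prop :=
  forall (z : R[i]) (m : int),
    f (z + m%:~R) =
    cexp (2 * 'i%C * pi%:C * alpha%:C * m%:~R)
    * cexp (nu%:C * (z + m%:~R / 2) * m%:~R) * f z.

Definition fock nu alpha : set (R[i] -> R[i]) :=
  [set f | [/\ entire f, quasi_periodic nu alpha f
             & (fock_sqnorm nu f < +oo)%E]].

Definition fock_basis nu alpha (n : int) (z : R[i]) : R[i] :=
  ((2 * nu / pi) `^ 4^-1)%:C * cexp ((nu / 2)%:C * z ^+ 2)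
  * cexp (- (pi ^+ 2 / nu)%:C * (n%:~R + alpha%:C) ^+ 2
          + 2 * 'i%C * pi%:C * (alpha%:C + n%:~R) * z).

Definition fock_kernel nu alpha (z w : R[i]) : R[i] :=
  ((2 * nu / pi) `^ 2^-1)%:C * cexp ((nu / 2)%:C * (z ^+ 2 + (w^*)%C ^+ 2))
  * theta alpha 0 (z - (w^*)%C) (2 * 'i%C * pi%:C / nu%:C).

End ThetaFock.

(* Main.v *)
Require Import Defs.
From HB Require Import structures.
From mathcomp Require Import all_boot all_order all_algebra.
From mathcomp Require Import all_classical all_reals all_analysis.
From mathcomp Require Import measurable_realfun complex ring lra zify.

Set Implicit Arguments.
Unset Strict Implicit.
Unset Printing Implicit Defensive.

Import Order.TTheory GRing.Theory Num.Theory.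
Import numFieldNormedType.Exports.
Import Normc.

Local Open Scope classical_set_scope.
Local Open Scope ring_scope.
Local Open Scope complex_scope.

(** Each [psi n = fock_basis nu alpha n] is the exponential of a quadratic
polynomial, hence has no zero, and it satisfies the same quasi-periodicity as
every [f] in the space. So [f / psi n] is entire with period 1. Moreover
[|psi n|^2] times the Gaussian weight depends on [y] alone and is a normal
density in [y], of total mass 1.

By Cauchy's theorem on a rectangle of width 1 the mean of a periodic entire
function over a horizontal period does not depend on the height
([entire_periodic_mean]). As [entire] only asks for pointwise complex
derivatives, this rests on Goursat's bisection ([Goursat_rectangle]). Fubini on
the strip then gives
  [<f, psi n>] = mean of [f / psi n] over a period, at any height
([fock_dot_basis]). The [psi n] are therefore orthonormal, and
[<f, psi n> psi n z] is [psi 0 z] times the [n]th term at [z] of the Fourier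
series of [f / psi 0].

The Fourier series of a periodic entire function converges to it at each point
([fourier_expansion]), by telescoping against a difference quotient and Bessel's
inequality on [[0, 1]]. Hence [f z] is the limit of the partial sums of
[<f, psi n> psi n z] ([fock_expansion]). These partial sums are the inner
products of [f] with the partial sums of the kernel [K_z], so Cauchy-Schwarz gives
[|f z| <= ||f|| sqrt (K z z)] ([fock_bound]); the Gaussian decay of [psi n] makes
this uniform on compact sets ([fock_locally_bounded]).

For completeness, the pointwise bound makes a Cauchy sequence converge at each
point, and Fatou's lemma bounds the norm of the limit. That the limit is entire
follows without Cauchy's integral formula: each [psi n] has a quadratic bound on
its first-order remainder, with constants summable in [n]; the expansion passes
this to every [f], with a constant proportional to [||f||] ([fock_quad_diff]), and
such bounds survive pointwise limits ([quad_diff_lim]).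

Finally, a series [b n psi n] with square-summable coefficients that converges
pointwise to [F] converges to [F] in norm ([fock_sum_cvg]). With
[b n = <f, psi n>] this is the density of the span of the [psi n]; with [b n] the
conjugate of [psi n w] it shows that [K_w] is in the space and, by continuity of
the inner product, that it reproduces. *)

(** * Norm and exponential of complex numbers *)

Section ComplexBasics.
Context {R : realType}.
Implicit Types (z w : R[i]) (x y : R).

Lemma normrc z : `|z| = (normc z)%:C.
Proof. by case: z. Qed.

Lemma normc_ge0 z : 0 <= normc z.
Proof. by case: z => a b; apply: sqrtr_ge0. Qed.

Lemma normc_sqr z : normc z ^+ 2 = complex.Re z ^+ 2 + complex.Im z ^+ 2.
Proof. by case: z => a b /=; rewrite sqr_sqrtr// addr_ge0// sqr_ge0. Qed.

Lemma normc_real x : normc x%:C = `|x|.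
Proof. by rewrite /= expr0n addr0 sqrtr_sqr. Qed.

Lemma normc_conj z : normc (z^*)%C = normc z.
Proof. by case: z => a b /=; rewrite sqrrN. Qed.

Lemma normc_Re z : `|complex.Re z| <= normc z.
Proof.
by case: z => a b /=; rewrite -sqrtr_sqr ler_wsqrtr// lerDl sqr_ge0.
Qed.

Lemma normc_Im z : `|complex.Im z| <= normc z.
Proof.
by case: z => a b /=; rewrite -sqrtr_sqr ler_wsqrtr// lerDr sqr_ge0.
Qed.

Lemma normc_le_ReIm z : normc z <= `|complex.Re z| + `|complex.Im z|.
Proof.
rewrite -(ler_pXn2r (_ : 0 < 2)%N) ?nnegrE ?normc_ge0 ?addr_ge0//.
rewrite normc_sqr sqrrD !real_normK ?num_real// -addrAC lerDl.
by rewrite mulrn_wge0 ?mulr_ge0.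
Qed.

Lemma normc_eq0P z : normc z = 0 <-> z = 0.
Proof. by split=> [/eq0_normc//|->]; rewrite normc0. Qed.

Lemma normc_gt0 z : (0 < normc z) = (z != 0).
Proof.
rewrite lt_def normc_ge0 andbT; apply: (congr1 negb).
by apply/eqP/eqP => /normc_eq0P.
Qed.

Lemma ler_normcB z w : normc (z - w) <= normc z + normc w.
Proof. by rewrite (le_trans (le_normcD _ _))// normcN. Qed.

Lemma normc_distrC z w : normc (z - w) = normc (w - z).
Proof. by rewrite -normcN opprB. Qed.

Lemma normc_sum (I : Type) (s : seq I) (F : I -> R[i]) :
  normc (\sum_(i <- s) F i) <= \sum_(i <- s) normc (F i).
Proof.
elim: s => [|i s IH]; first by rewrite !big_nil normc0.
by rewrite !big_cons (le_trans (le_normcD _ _))// lerD2l.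
Qed.

Lemma realcD x y : (x + y)%:C = x%:C + y%:C.
Proof. exact: rmorphD. Qed.

Lemma realcN x : (- x)%:C = - x%:C.
Proof. exact: rmorphN. Qed.

Lemma realcM x y : (x * y)%:C = x%:C * y%:C.
Proof. exact: rmorphM. Qed.

Lemma realcV x : (x^-1)%:C = (x%:C)^-1.
Proof. exact: fmorphV. Qed.

Lemma realcX x n : (x ^+ n)%:C = x%:C ^+ n.
Proof. exact: rmorphXn. Qed.

Lemma realc_nat n : (n%:R)%:C = n%:R :> R[i].
Proof. exact: rmorph_nat. Qed.

Lemma conjcD z w : ((z + w)^*)%C = (z^*)%C + (w^*)%C.
Proof. exact: rmorphD. Qed.

Lemma conjcN z : ((- z)^*)%C = - (z^*)%C.
Proof. exact: rmorphN. Qed.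

Lemma conjcM z w : ((z * w)^*)%C = (z^*)%C * (w^*)%C.
Proof. exact: rmorphM. Qed.

Lemma conjc_realC x : ((x%:C)^*)%C = x%:C.
Proof. by rewrite /= oppr0. Qed.

Lemma mul_conjc z : z * (z^*)%C = (normc z ^+ 2)%:C.
Proof. by case: z => a b; rewrite normc_sqr; simpc; congr (_ +i* _); ring. Qed.

Lemma cexpE z : cexp z =
  (expR (complex.Re z))%:C * (cos (complex.Im z) +i* sin (complex.Im z)).
Proof. by []. Qed.

Lemma cexpD z w : cexp (z + w) = cexp z * cexp w.
Proof.
case: z w => [a b] [c d]; rewrite /cexp /= expRD cosD sinD; simpc.
by congr (_ +i* _); ring.
Qed.

Lemma cexp0 : cexp 0 = 1 :> R[i].
Proof. by rewrite /cexp /= expR0 cos0 sin0; simpc. Qed.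

Lemma normc_cexp z : normc (cexp z) = expR (complex.Re z).
Proof.
rewrite /cexp normcM normc_real /= cos2Dsin2 sqrtr1 mulr1.
by rewrite ger0_norm// expR_ge0.
Qed.

Lemma cexp_neq0 z : cexp z != 0.
Proof. by rewrite -normc_gt0 normc_cexp expR_gt0. Qed.

Lemma cexpN z : cexp (- z) = (cexp z)^-1.
Proof.
apply: (mulIf (cexp_neq0 z)); rewrite mulVf ?cexp_neq0//.
by rewrite -cexpD addNr cexp0.
Qed.

Lemma conj_cexp z : ((cexp z)^*)%C = cexp (z^*)%C.
Proof. by case: z => a b; rewrite /cexp /= cosN sinN; simpc. Qed.

Lemma derive_le_norm (f df : R -> R) (K : R) :
  (forall x, is_derive x 1 f (df x)) -> f 0 = 0 ->
  forall x, (forall y, `|y| <= `|x| -> `|df y| <= K) -> `|f x| <= K * `|x|.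
Proof.
move=> fdf f0 x Hx.
have fc : continuous f.
  by move=> y; apply/differentiable_continuous/derivable1_diffP; case: (fdf y).
have K0 : 0 <= K by rewrite (le_trans _ (Hx 0 _))// normr0.
have fcw a b : {within `[a, b], continuous f} by exact: continuous_subspaceT.
have [x0|x0|->] := ltgtP x 0; last by rewrite f0 !normr0 mulr0.
- have [c] := MVT_segment (ltW x0) (fun y _ => fdf y) (fcw x 0).
  rewrite in_itv /= f0 !sub0r => /andP[c1 c2].
  move=> /(congr1 Num.norm); rewrite normrN normrM normrN => ->.
  by rewrite ler_wpM2r// Hx// !ler0_norm// ?(ltW x0)// lerN2.
- have [c] := MVT_segment (ltW x0) (fun y _ => fdf y) (fcw 0 x).
  rewrite in_itv /= f0 !subr0 => /andP[c1 c2].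
  move=> /(congr1 Num.norm); rewrite normrM => ->.
  by rewrite ler_wpM2r// Hx// !ger0_norm// (ltW x0).
Qed.

Lemma expR_sub1_le x : `|expR x - 1| <= expR `|x| * `|x|.
Proof.
apply: (@derive_le_norm (fun x => expR x - 1) (fun x => expR x)) => //.
- by move=> y; apply: is_derive_eq; rewrite subr0.
- by rewrite expR0 subrr.
- move=> y yx; rewrite ger0_norm ?expR_ge0// ler_expR.
  by rewrite (le_trans (ler_norm _)).
Qed.

Lemma expR_sub1_sub_le x : `|expR x - 1 - x| <= expR `|x| * `|x| ^+ 2.
Proof.
rewrite expr2 mulrA.
apply: (@derive_le_norm (fun x => expR x - 1 - x) (fun x => expR x - 1)) => //.
- by move=> y; apply: is_derive_eq; rewrite subr0.
- by rewrite expR0 !subrr.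
- move=> y yx; rewrite (le_trans (expR_sub1_le _))//.
  by rewrite ler_pM ?expR_ge0// ler_expR.
Qed.

Lemma sin_le_norm x : `|sin x| <= `|x|.
Proof.
rewrite -[leRHS]mul1r; apply: (@derive_le_norm sin cos) => //; first exact: sin0.
by move=> y _; exact: cos_max.
Qed.

Lemma cos_sub1_le x : `|cos x - 1| <= `|x| ^+ 2.
Proof.
rewrite expr2; apply: (@derive_le_norm (fun x => cos x - 1) (fun x => - sin x)).
- by move=> y; apply: is_derive_eq; rewrite subr0.
- by rewrite cos0 subrr.
- by move=> y yx; rewrite normrN (le_trans (sin_le_norm _)).
Qed.

Lemma sin_sub_le x : `|sin x - x| <= `|x| ^+ 2.
Proof.
rewrite expr2.
apply: (@derive_le_norm (fun x => sin x - x) (fun x => cos x - 1)).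
- by rewrite (sin0 R) subr0.
- move=> y yx; rewrite (le_trans _ yx)// -[leRHS]mul1r.
  apply: (@derive_le_norm (fun x => cos x - 1) (fun x => - sin x)) => //.
  + by move=> t; apply: is_derive_eq; rewrite subr0.
  + by rewrite cos0 subrr.
  + by move=> t _; rewrite normrN sin_max.
Qed.

(** The remainder splits into those of [expR], [cos] and [sin], each estimated
by the mean value theorem. *)
Lemma cexp_sub1_sub_le z :
  normc (cexp z - 1 - z) <= 4 * expR (normc z) * normc z ^+ 2.
Proof.
have -> : cexp z - 1 - z =
   ((expR (complex.Re z) - 1 - complex.Re z)
     + expR (complex.Re z) * (cos (complex.Im z) - 1)) +i*
   (expR (complex.Re z) * (sin (complex.Im z) - complex.Im z)
     + (expR (complex.Re z) - 1) * complex.Im z).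
  by case: z => x y; rewrite /cexp /=; simpc; congr (_ +i* _); ring.
rewrite (le_trans (normc_le_ReIm _))//=.
have := normc_ge0 z; have := normc_Re z; have := normc_Im z.
move: (normc z) => r; move: (complex.Re z) (complex.Im z) => x y yr xr r0.
set M := expR r.
have M0 : 0 < M by exact: expR_gt0.
have xM : expR `|x| <= M by rewrite ler_expR.
have xM' : expR x <= M by rewrite ler_expR (le_trans _ xr)// ler_norm.
have sq (t : R) : `|t| <= r -> `|t| ^+ 2 <= r ^+ 2.
  by move=> tr; rewrite ler_pXn2r// nnegrE.
have h1 : `|expR x - 1 - x| <= M * r ^+ 2.
  by rewrite (le_trans (expR_sub1_sub_le _))// ler_pM ?expR_ge0 ?sq// sqr_ge0.
have h2 : `|expR x * (cos y - 1)| <= M * r ^+ 2.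
  rewrite normrM ler_pM// ?(le_trans (cos_sub1_le _)) ?sq//.
  by rewrite ger0_norm ?expR_ge0.
have h3 : `|expR x * (sin y - y)| <= M * r ^+ 2.
  rewrite normrM ler_pM// ?(le_trans (sin_sub_le _)) ?sq//.
  by rewrite ger0_norm ?expR_ge0.
have h4 : `|(expR x - 1) * y| <= M * r ^+ 2.
  rewrite normrM expr2 mulrA ler_pM// (le_trans (expR_sub1_le _))//.
  by rewrite ler_pM// ?expR_ge0.
rewrite (le_trans (lerD (ler_normD _ _) (ler_normD _ _)))//.
by rewrite (le_trans (lerD (lerD h1 h2) (lerD h3 h4)))// -/r; nra.
Qed.

End ComplexBasics.

(* Keeps unification from unfolding exponentials into products. *)
Opaque cexp.

(** * Convergence and differentiability with real-valued norms *)

Section ComplexLimits.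
Context {R : realType}.

Lemma gt0_complexP (e : R[i]) : 0 < e -> exists2 r : R, 0 < r & e = r%:C.
Proof. by case: e => a b; rewrite ltcE /= => /andP[/eqP-> a0]; exists a. Qed.

Implicit Types (z w l : R[i]) (u v : nat -> R[i]).

(** Convergence in the complex plane, put through the real-valued norm so that
the squeeze and comparison results of the real line apply. *)
Definition clim u l := (fun n => normc (u n - l)) @ \oo --> (0 : R).

Lemma clim_squeeze u l (e : nat -> R) :
  (forall n, normc (u n - l) <= e n) -> e @ \oo --> (0 : R) -> clim u l.
Proof.
move=> ue e0; apply: (squeeze_cvgr _ (cvg_cst 0) e0).
by apply: nearW => n; rewrite normc_ge0 ue.
Qed.

Lemma clim_cst z : clim (fun=> z) z.
Proof. by rewrite /clim subrr normc0; exact: cvg_cst. Qed.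

Lemma climD u v l w : clim u l -> clim v w -> clim (fun n => u n + v n) (l + w).
Proof.
move=> ul vw; apply: clim_squeeze (_ : (_ \+ _) @ \oo --> _); last first.
  by rewrite -[0]addr0; exact: cvgD ul vw.
by move=> n /=; rewrite opprD addrACA le_normcD.
Qed.

Lemma climZ a u l : clim u l -> clim (fun n => a * u n) (a * l).
Proof.
move=> ul; apply: clim_squeeze (_ : (normc a \*o _) @ \oo --> _); last first.
  by rewrite -[0](mulr0 (normc a)); apply: cvgM ul; exact: cvg_cst.
by move=> n /=; rewrite -mulrBr normcM.
Qed.

Lemma climB u v l w : clim u l -> clim v w -> clim (fun n => u n - v n) (l - w).
Proof.
move=> ul /(climZ (-1)); rewrite mulN1r => /(climD ul).
by under eq_fun do rewrite mulN1r.
Qed.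

Lemma clim_epsP u l : clim u l <->
  forall e : R, 0 < e -> exists N, forall n, (N <= n)%N -> normc (u n - l) <= e.
Proof.
split=> [/cvgrPdist_le ul e /ul [N _ Nu]|ul].
  by exists N => n /Nu /=; rewrite sub0r normrN ger0_norm ?normc_ge0.
apply/cvgrPdist_le => e /ul [N Nu]; exists N => // n /= /Nu.
by rewrite sub0r normrN ger0_norm ?normc_ge0.
Qed.

Lemma clim_shift u l : clim (fun n => u n.+1) l -> clim u l.
Proof. by move=> ul; rewrite /clim -(cvg_shiftS (fun n => normc (u n - l))). Qed.

Lemma ler_dist_normc z w : `|normc z - normc w| <= normc (z - w).
Proof.
rewrite ler_norml; apply/andP; split.
  by have := le_normcD (w - z) z; rewrite subrK normc_distrC; lra.
by have := le_normcD (z - w) w; rewrite subrK; lra.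
Qed.

Lemma clim_norm u l : clim u l -> (fun n => normc (u n)) @ \oo --> normc l.
Proof.
move/clim_epsP => ul; apply/cvgrPdist_le => e /ul[N Nu].
exists N => // n /= /Nu; rewrite distrC; apply: le_trans; exact: ler_dist_normc.
Qed.

Lemma clim_norm_le u l (M : R) :
  clim u l -> (forall n, normc (u n) <= M) -> normc l <= M.
Proof.
move=> /clim_norm ul uM; rewrite -(cvg_lim _ ul)//.
by apply: limr_le; [apply/cvg_ex; exists (normc l)|exact: nearW].
Qed.

Lemma clim_unique u l w : clim u l -> clim u w -> l = w.
Proof.
move=> ul uw; apply/eqP; rewrite -subr_eq0; apply/eqP/normc_eq0P.
have := climB ul uw; under eq_fun do rewrite subrr.
rewrite /clim; under eq_fun do rewrite sub0r normcN.
move=> /(cvg_lim (@Rhausdorff R)) <-; apply/esym/cvg_lim => //; exact: cvg_cst.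
Qed.

Lemma cauchy_real_cvg (f : nat -> R) :
  (forall e : R, 0 < e ->
     exists N, forall m n, (N <= m)%N -> (N <= n)%N -> `|f m - f n| <= e) ->
  exists l : R, f @ \oo --> l.
Proof.
move=> fC; apply/cvg_ex/cauchy_cvgP/cauchy_exP => e e0.
have [|N Nf] := fC (e / 2); first by rewrite divr_gt0.
exists (f N); exists N => // n /= Nn; rewrite -ball_normE /=.
by rewrite (le_lt_trans (Nf _ _ _ _))// gtr_pMr// invf_lt1// ltr1n.
Qed.

(** Both coordinates of a Cauchy sequence are Cauchy in the complete line. *)
Lemma clim_cauchy u :
  (forall e : R, 0 < e ->
     exists N, forall m n, (N <= m)%N -> (N <= n)%N -> normc (u m - u n) <= e) ->
  exists l, clim u l.
Proof.
move=> uC.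
have [a ua] : exists a : R, (fun n => complex.Re (u n)) @ \oo --> a.
  apply: cauchy_real_cvg => e /uC[N Nu]; exists N => m n Nm Nn.
  by rewrite -raddfB (le_trans (normc_Re _))// Nu.
have [b ub] : exists b : R, (fun n => complex.Im (u n)) @ \oo --> b.
  apply: cauchy_real_cvg => e /uC[N Nu]; exists N => m n Nm Nn.
  by rewrite -raddfB (le_trans (normc_Im _))// Nu.
exists (a +i* b).
apply: clim_squeeze (fun n => normc_le_ReIm _) _.
under eq_fun do rewrite !raddfB/=.
rewrite -[0]addr0 -[X in X + _](normr0 R) -[X in _ + X](normr0 R).
by apply: cvgD; apply: cvg_norm; apply/subr_cvg0.
Qed.

Lemma clim_cvg u l : clim u l -> (u : nat -> R[i]^o) @ \oo --> (l : R[i]^o).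
Proof.
move=> /clim_epsP ul; apply/cvgrPdist_le => _ /gt0_complexP[e e0 ->].
have [N Nu] := ul _ e0; exists N => // n /= /Nu nu.
by rewrite distrC; change (`|u n - l| <= e%:C); rewrite normrc lecR.
Qed.

Lemma clim_lim u l : clim u l -> lim ((u : nat -> R[i]^o) @ \oo) = l.
Proof. by move=> /clim_cvg; apply: cvg_lim; exact: norm_hausdorff. Qed.

Lemma clim_series_dom (t : nat -> R[i]) (M : nat -> R) (B : R) :
  (forall n, normc (t n) <= M n) -> (forall N, \sum_(0 <= n < N) M n <= B) ->
  exists l, clim (series t) l.
Proof.
move=> tM MB; apply: clim_cauchy => e e0.
have M0 n : 0 <= M n by rewrite (le_trans (normc_ge0 _) (tM n)).
have cM : cvgn (series M).
  apply: nondecreasing_is_cvgn.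
    by apply/nondecreasing_seqP => n; rewrite /series/= big_nat_recr//= lerDl.
  by exists B => _ [n _ <-]; exact: MB.
have /cauchy_cvgP/cauchy_seriesP/(_ e e0)[[A1 A2] [[N1 _ NA1] [N2 _ NA2]] NA] := cM.
have key m n : (maxn N1 N2 <= m)%N -> (m <= n)%N ->
    normc (series t n - series t m) <= e.
  rewrite geq_max => /andP[N1m N2m] mn.
  have N2n : (N2 <= n)%N by exact: leq_trans mn.
  rewrite sub_series_geq// (le_trans (normc_sum _ _))//.
  have /= := NA (m, n) (conj (NA1 _ N1m) (NA2 _ N2n)).
  rewrite ger0_norm ?sumr_ge0// => /ltW; apply: le_trans.
  by apply: ler_sum => k _; exact: tM.
exists (maxn N1 N2) => m n Nm Nn; have [mn|/ltnW nm] := leqP m n.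
  by rewrite normc_distrC key.
exact: key.
Qed.

End ComplexLimits.

Section ComplexDerivatives.
Context {R : realType}.
Implicit Types (z w h D : R[i]) (f g : R[i] -> R[i]) (C : R).

(** Complex differentiability with real epsilons and deltas, which the real
estimates below consume directly. *)
Definition has_cderiv f z D := forall e : R, 0 < e -> exists2 d : R, 0 < d &
  forall h, normc h < d -> normc (f (z + h) - f z - D * h) <= e * normc h.

Lemma derivable_has_cderiv f z :
  derivable (f : R[i]^o -> R[i]^o) z 1 <-> exists D, has_cderiv f z D.
Proof.
split=> [/cvg_ex[/= D /cvgrPdist_le fD]|[D fD]].
  exists D => e e0.
  have e0' : (0 : R[i]) < e%:C by rewrite ltcR.
  have /nbhs_ballP[/= _ /gt0_complexP[d d0 ->] dP] := fD _ e0'.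
  exists d => // h hd; have [->|h0] := eqVneq h 0.
    by rewrite addr0 subrr mulr0 subrr normc0 mulr0.
  have := dP h; rewrite -ball_normE /= sub0r normrN.
  have hd' : `|h| < d%:C by rewrite normrc ltcR.
  move=> /(_ hd' h0) hP.
  have -> : f (z + h) - f z - D * h = - (D - h^-1 * (f (h + z) - f z)) * h.
    by rewrite (addrC h); field.
  rewrite normcM normcN ler_wpM2r ?normc_ge0// -lecR -normrc.
  by move: hP; rewrite /GRing.scale /= mulr1.
apply/cvg_ex; exists D; apply/cvgrPdist_le => _ /gt0_complexP[e e0 ->].
have [d d0 dP] := fD _ e0.
apply/nbhs_ballP; exists d%:C; first by rewrite /= ltcR.
move=> h; rewrite -ball_normE /= sub0r normrN => hd h0.
have {}hd : normc h < d by rewrite -ltcR -normrc.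
rewrite /GRing.scale /= mulr1.
change (`|D - h^-1 * (f (h + z) - f z)| <= e%:C); rewrite normrc lecR.
rewrite -(ler_pM2r (_ : 0 < normc h)) ?normc_gt0// -normcM.
rewrite -[X in X <= _]normcN (le_trans _ (dP _ hd))// le_eqVlt; apply/orP; left.
by apply/eqP; congr normc; rewrite (addrC h); field.
Qed.

(** Differentiability with an explicit quadratic bound on the remainder: unlike
differentiability itself, it passes to pointwise limits when [C] is fixed. *)
Definition quad_diff C f z := exists D, forall h, normc h <= 1 ->
  normc (f (z + h) - f z - D * h) <= C * normc h ^+ 2.

Lemma has_cderiv_quad C f z D : (forall h, normc h <= 1 ->
    normc (f (z + h) - f z - D * h) <= C * normc h ^+ 2) -> has_cderiv f z D.
Proof.
move=> fD e e0.
have C0 : 0 <= C.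
  have := fD 1; rewrite normc1 lexx expr1n !mulr1 => /(_ isT) h.
  by rewrite (le_trans (normc_ge0 _) h).
exists (Num.min 1 (e / (C + 1))).
  by rewrite lt_min ltr01 divr_gt0// ltr_wpDl.
move=> h; rewrite lt_min => /andP[h1 hC]; rewrite (le_trans (fD _ (ltW h1)))//.
rewrite expr2 mulrA ler_wpM2r ?normc_ge0//.
rewrite ltr_pdivlMr ?ltr_wpDl// in hC.
by have := normc_ge0 h; nra.
Qed.

Lemma quad_diff_derivable C f z :
  quad_diff C f z -> derivable (f : R[i]^o -> R[i]^o) z 1.
Proof.
case=> D fD; apply/derivable_has_cderiv; exists D; exact: has_cderiv_quad fD.
Qed.

(** Difference quotients with a small increment [r] recover the derivatives up to
[C * r], uniformly along the sequence, so the derivatives form a Cauchy sequence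
because the values do. *)
Lemma quad_diff_lim C (F : nat -> R[i] -> R[i]) f z :
  (forall n, quad_diff C (F n) z) -> (forall w, clim (F^~ w) (f w)) ->
  quad_diff C f z.
Proof.
move=> FC Ff; have [D FD] := choice FC.
have C0 : 0 <= C.
  have := FD 0%N 1; rewrite normc1 lexx expr1n !mulr1 => /(_ isT) h.
  by rewrite (le_trans (normc_ge0 _) h).
have [l Dl] : exists l, clim D l.
  apply: clim_cauchy => e e0.
  pose r := Num.min 1 (e / (4 * (C + 1))).
  have r0 : 0 < r by rewrite lt_min ltr01 divr_gt0// mulr_gt0// ltr_wpDl.
  have r1 : r <= 1 by rewrite ge_min lexx.
  have re : 4 * C * r <= e.
    have : r <= e / (4 * (C + 1)) by rewrite ge_min lexx orbT.
    by rewrite ler_pdivlMr ?mulr_gt0 ?ltr_wpDl//; nra.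
  have nr : normc r%:C = r by rewrite normc_real gtr0_norm.
  have er : 0 < e * r / 8 by rewrite divr_gt0// mulr_gt0.
  have /clim_epsP/(_ _ er)[N1 H1] := Ff (z + r%:C).
  have /clim_epsP/(_ _ er)[N2 H2] := Ff z.
  exists (maxn N1 N2) => m n; rewrite !geq_max => /andP[m1 m2] /andP[n1 n2].
  have hm := FD m r%:C; have hn := FD n r%:C; rewrite nr in hm hn.
  have := H1 _ m1; have := H1 _ n1; have := H2 _ m2; have := H2 _ n2.
  move: (hm r1) (hn r1) => {}hm {}hn.
  set a1 := F m (z + r%:C) in hm *; set a2 := F m z in hm *.
  set b1 := F n (z + r%:C) in hn *; set b2 := F n z in hn *.
  set c1 := f (z + r%:C); set c2 := f z => t1 t2 t3 t4.
  rewrite -(ler_pM2r r0) -[X in _ * X <= _]nr -normcM.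
  have -> : (D m - D n) * r%:C = (b1 - b2 - D n * r%:C)
     - (a1 - a2 - D m * r%:C) + ((a1 - c1) - (b1 - c1) - ((a2 - c2) - (b2 - c2))).
    by ring.
  rewrite (le_trans (le_normcD _ _))//.
  have k1 := ler_normcB (b1 - b2 - D n * r%:C) (a1 - a2 - D m * r%:C).
  have k2 := ler_normcB ((a1 - c1) - (b1 - c1)) ((a2 - c2) - (b2 - c2)).
  have k3 := ler_normcB (a1 - c1) (b1 - c1).
  have k4 := ler_normcB (a2 - c2) (b2 - c2).
  have re2 : 4 * C * r ^+ 2 <= e * r by rewrite expr2 mulrA ler_wpM2r// ltW.
  by lra.
exists l => h h1; apply: clim_norm_le (fun n => FD n h h1).
apply: climB; first by apply: climB; exact: Ff.
by under eq_fun do rewrite mulrC; rewrite mulrC; apply: climZ.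
Qed.

End ComplexDerivatives.

(** * Exponentials of quadratic polynomials *)

Section GaussianExponentials.
Context {R : realType}.
Implicit Types (a b c z w h : R[i]).

(** At [z + h] the polynomial grows by [w = h (2 a z + b) + a h^2], and
[cexp w - 1 - w] is quadratic in [h]. *)
Lemma cexp_quad_diff a b c z :
  quad_diff (normc (cexp (a * z ^+ 2 + b * z + c)) *
     (4 * expR (normc (2 * a * z + b) + normc a) *
        (normc (2 * a * z + b) + normc a) ^+ 2 + normc a))
    (fun w => cexp (a * w ^+ 2 + b * w + c)) z.
Proof.
set E := cexp _; set L := normc _ + _.
exists (E * (2 * a * z + b)) => h h1; set w := h * (2 * a * z + b) + a * h ^+ 2.
have wL : normc w <= normc h * L.
  rewrite (le_trans (le_normcD _ _))// !normcM mulrDr lerD2l.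
  rewrite mulrCA.
  by rewrite ler_wpM2l ?normc_ge0// ler_piMr ?normc_ge0.
have L0 : 0 <= L by rewrite addr_ge0 ?normc_ge0.
have -> : a * (z + h) ^+ 2 + b * (z + h) + c = (a * z ^+ 2 + b * z + c) + w.
  by rewrite /w; ring.
have -> : cexp (a * z ^+ 2 + b * z + c + w) - E - E * (2 * a * z + b) * h =
   E * ((cexp w - 1 - w) + a * h ^+ 2).
  by rewrite cexpD -/E /w; ring.
rewrite normcM -[leRHS]mulrA ler_wpM2l ?normc_ge0//.
rewrite (le_trans (le_normcD _ _))// mulrDl normcM expr2 normcM -expr2 lerD2r.
rewrite (le_trans (cexp_sub1_sub_le _))//.
have wL' : normc w <= L by rewrite (le_trans wL)// ler_piMl.
rewrite -!mulrA ler_wpM2l// ler_pM ?expR_ge0 ?sqr_ge0 ?ler_expR//.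
rewrite mulrA -expr2 -exprMn mulrC ler_pXn2r ?nnegrE ?normc_ge0//.
by rewrite mulr_ge0 ?normc_ge0.
Qed.

Lemma entire_cexp_quad a b c : entire (fun w => cexp (a * w ^+ 2 + b * w + c)).
Proof. by move=> z; apply: quad_diff_derivable (cexp_quad_diff a b c z). Qed.

Lemma quad_diffZ k C (f : R[i] -> R[i]) z :
  quad_diff C f z -> quad_diff (normc k * C) (fun w => k * f w) z.
Proof.
case=> D fD; exists (k * D) => h h1.
have -> : k * f (z + h) - k * f z - k * D * h = k * (f (z + h) - f z - D * h).
  by ring.
by rewrite normcM -mulrA ler_wpM2l ?normc_ge0 ?fD.
Qed.

Lemma quad_diff_sum (I : Type) (s : seq I) (C : I -> R) (f : I -> R[i] -> R[i]) z :
  (forall i, quad_diff (C i) (f i) z) ->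
  quad_diff (\sum_(i <- s) C i) (fun w => \sum_(i <- s) f i w) z.
Proof.
move=> /choice[D fD]; exists (\sum_(i <- s) D i) => h h1.
rewrite mulr_suml -!sumrB mulr_suml (le_trans (normc_sum _ _))//.
by apply: ler_sum => i _; exact: fD.
Qed.

Lemma quad_diff_le C C' (f : R[i] -> R[i]) z : C <= C' ->
  quad_diff C f z -> quad_diff C' f z.
Proof.
move=> CC' [D fD]; exists D => h h1.
by rewrite (le_trans (fD _ h1))// ler_wpM2r// sqr_ge0.
Qed.

End GaussianExponentials.

(** * Sums over the integers *)

Section IntegerSums.
Context {R : realType}.

Definition zannulus (m n : nat) : seq int :=
  [seq Posz k | k <- index_iota m n] ++ [seq Negz k | k <- index_iota m n].

(** The integers from [- N] to [N - 1]: sums over it add the [N]th partial sums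
of the two series in [zsum]. *)
Definition zwindow (N : nat) : seq int := zannulus 0 N.

Lemma zannulus_uniq m n : uniq (zannulus m n).
Proof.
rewrite cat_uniq !map_inj_uniq ?iota_uniq; [|by move=> ? ? []..].
by rewrite andbT; apply/hasPn => _ /mapP[k _ ->]; apply/mapP => -[].
Qed.

Lemma zwindow_uniq N : uniq (zwindow N).
Proof. exact: zannulus_uniq. Qed.

Lemma big_zannulus (V : nmodType) m n (u : int -> V) :
  \sum_(k <- zannulus m n) u k =
  \sum_(m <= k < n) u (Posz k) + \sum_(m <= k < n) u (Negz k).
Proof. by rewrite big_cat !big_map. Qed.

Lemma big_zwindow (V : nmodType) N (u : int -> V) :
  \sum_(n <- zwindow N) u n =
  \sum_(0 <= n < N) u (Posz n) + \sum_(0 <= n < N) u (Negz n).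
Proof. exact: big_zannulus. Qed.

Lemma sub_zwindow (V : zmodType) m n (u : int -> V) : (m <= n)%N ->
  \sum_(k <- zwindow n) u k - \sum_(k <- zwindow m) u k =
  \sum_(k <- zannulus m n) u k.
Proof.
move=> mn; rewrite !big_zwindow big_zannulus opprD addrACA.
rewrite (big_cat_nat (n := m))//=.
rewrite (big_cat_nat (n := m) (p := n) (F := fun k => u (Negz k)))//=.
by rewrite ![_ + _ - _]addrC !addKr.
Qed.

Lemma sum_half_le N : \sum_(0 <= n < N) (2^-1 : R) ^+ n <= 2.
Proof.
suff -> : \sum_(0 <= n < N) (2^-1 : R) ^+ n = 2 - 2 * 2^-1 ^+ N.
  by rewrite gerBl mulr_ge0// exprn_ge0.
elim: N => [|N IH]; first by rewrite big_nil expr0 mulr1 subrr.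
by rewrite big_nat_recr//= IH exprS; field.
Qed.

Lemma sum_zwindow_half_le N : \sum_(n <- zwindow N) (2^-1 : R) ^+ `|n| <= 4.
Proof.
rewrite big_zwindow (_ : 4 = 2 + 2)//; last by ring.
rewrite lerD ?sum_half_le// (le_trans _ (sum_half_le N))//.
by apply: ler_sum => n _; rewrite /= exprS ler_piMl ?exprn_ge0// invf_le1// ler1n.
Qed.

Lemma clim_zsum (u : int -> R[i]) (C : R) :
  (forall n, normc (u n) <= C * 2^-1 ^+ `|n|) ->
  clim (fun N => \sum_(n <- zwindow N) u n) (zsum u).
Proof.
move=> uC; have C0 : 0 <= C.
  by have := uC 0; rewrite expr0 mulr1; apply: le_trans; exact: normc_ge0.
have [l1 h1] : exists l, clim (series (fun n => u (Posz n))) l.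
  apply: (clim_series_dom (M := fun n => C * 2^-1 ^+ n) (B := C * 2)).
    by move=> n; exact: uC.
  by move=> N; rewrite -mulr_sumr ler_wpM2l// sum_half_le.
have [l2 h2] : exists l, clim (series (fun n => u (Negz n))) l.
  apply: (clim_series_dom (M := fun n => C * 2^-1 ^+ n) (B := C * 2)).
    move=> n; rewrite (le_trans (uC _))// ler_wpM2l//= exprS.
    by rewrite ler_piMl ?exprn_ge0 ?invr_ge0// invf_le1// ler1n.
  by move=> N; rewrite -mulr_sumr ler_wpM2l// sum_half_le.
rewrite /zsum (clim_lim h1) (clim_lim h2).
by under eq_fun do rewrite big_zwindow; exact: climD.
Qed.

End IntegerSums.

(** * Decay and analyticity of the theta basis *)

Section ThetaBasis.
Context {R : realType}.
Variables (nu alpha : R).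
Hypothesis nu_gt0 : 0 < nu.
Implicit Types (z w : R[i]) (n : int).
Local Notation psi := (fock_basis nu alpha).

Lemma real_intD n : n%:~R + alpha%:C = (n%:~R + alpha)%:C :> R[i].
Proof. by rewrite rmorphD/= rmorph_int. Qed.

Lemma fock_basisE n z : psi n z = ((2 * nu / pi) `^ 4^-1)%:C *
  cexp ((nu / 2)%:C * z ^+ 2 + (2 * pi * (n%:~R + alpha))%:C * 'i%C * z
        + (- (pi ^+ 2 / nu * (n%:~R + alpha) ^+ 2))%:C).
Proof.
rewrite /fock_basis -mulrA -cexpD; congr (_ * cexp _).
rewrite (addrC alpha%:C) real_intD; set t := n%:~R + alpha.
have -> : (- (pi ^+ 2 / nu * t ^+ 2))%:C = - (pi ^+ 2 / nu)%:C * t%:C ^+ 2.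
  by rewrite rmorphN rmorphM mulNr; congr (- (_ * _)); exact: rmorphXn.
by rewrite !rmorphM/=; ring.
Qed.

Lemma normc_fock_basis n x y : normc (psi n (x +i* y)) =
  (2 * nu / pi) `^ 4^-1 * expR (nu / 2 * (x ^+ 2 - y ^+ 2)
     - 2 * pi * (n%:~R + alpha) * y - pi ^+ 2 / nu * (n%:~R + alpha) ^+ 2).
Proof.
rewrite fock_basisE normcM normc_real normc_cexp ger0_norm ?powR_ge0//.
congr (_ * expR _); rewrite expr2; simpc => /=; ring.
Qed.

Lemma fock_basis_neq0 n z : psi n z != 0.
Proof.
rewrite fock_basisE mulf_neq0 ?cexp_neq0// -normc_gt0 normc_real.
by rewrite normr_gt0 gt_eqF// powR_gt0// divr_gt0 ?pi_gt0// mulr_gt0.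
Qed.

(** The Gaussian factor [exp (- pi^2 / nu * (n + alpha)^2)] beats every
exponential in [|n|]; the factor [expR (B * |n|)] leaves room for the
polynomial and exponential losses of [fock_basis_quad_diff]. *)
Lemma fock_basis_dom (r B : R) : 0 <= r -> 0 <= B ->
  exists C, 0 <= C /\ forall n z, normc z <= r ->
    normc (psi n z) * expR (B * `|n%:~R|) <= C * 2^-1 ^+ `|n|.
Proof.
move=> r0 B0; set A := pi ^+ 2 / nu.
have A0 : 0 < A by rewrite divr_gt0// exprn_gt0// pi_gt0.
set B1 := B + 1; set b := 2 * pi * r + B1.
set c := (2 * nu / pi) `^ 4^-1; have c0 : 0 <= c by exact: powR_ge0.
exists (c * expR (nu / 2 * r ^+ 2 + B1 * `|alpha| + b ^+ 2 / (4 * A))); split.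
  by rewrite mulr_ge0// expR_ge0.
move=> n z zr; set t := n%:~R + alpha.
have nt : `|n%:~R : R| <= `|t| + `|alpha|.
  by rewrite -{1}[n%:~R](addrK alpha) ler_normB.
have h2 : expR (- `|n%:~R : R|) <= 2^-1 ^+ `|n|.
  have -> : - `|n%:~R : R| = `|n|%:R * - 1.
    by rewrite mulrN1 -intr_norm -abszE pmulrn.
  rewrite expRM_natl lerXn2r ?nnegrE ?expR_ge0 ?invr_ge0// expRN.
  by rewrite lef_pV2 ?posrE ?expR_gt0// (le_trans _ (expR_ge1Dx _)).
rewrite (le_trans _ (ler_wpM2l _ h2)) ?mulr_ge0 ?expR_ge0//.
move: zr; case: z => x y zr.
have yr : `|y| <= r := le_trans (normc_Im (x +i* y)) zr.
have xyr : x ^+ 2 - y ^+ 2 <= r ^+ 2.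
  have : normc (x +i* y) ^+ 2 <= r ^+ 2 by rewrite ler_pXn2r ?nnegrE ?normc_ge0.
  by rewrite normc_sqr/=; have := sqr_ge0 y; lra.
rewrite normc_fock_basis -/t -/c -/A -[leLHS]mulrA -[leRHS]mulrA.
rewrite ler_wpM2l// -!expRD ler_expR.
have ty : - (2 * pi * t * y) <= 2 * pi * r * `|t|.
  rewrite (le_trans (ler_norm _))// normrN !normrM.
  rewrite (ger0_norm (pi_ge0 R)) ger0_norm// -!mulrA !ler_wpM2l ?pi_ge0//.
  by rewrite mulrC ler_wpM2r.
have sq : b * `|t| - A * t ^+ 2 <= b ^+ 2 / (4 * A).
  have A4 : 0 < 4 * A by lra.
  rewrite ler_pdivlMr//.
  have -> : t ^+ 2 = `|t| ^+ 2 by rewrite real_normK ?num_real.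
  by have := sqr_ge0 (2 * A * `|t| - b); nra.
have nB : B1 * `|n%:~R : R| <= B1 * `|t| + B1 * `|alpha|.
  by rewrite -mulrDr ler_wpM2l// addr_ge0.
have nux : nu / 2 * (x ^+ 2 - y ^+ 2) <= nu / 2 * r ^+ 2.
  by rewrite ler_wpM2l// divr_ge0// ltW.
rewrite /b /B1 in sq nB *; set T := `|t| in ty sq nB *.
move: ty sq nB nux; rewrite !mulrDl !mul1r.
set e1 := 2 * pi * t * y; set e2 := 2 * pi * r * T; set e3 := B * T.
by set e4 := A * t ^+ 2; set e5 := nu / 2 * _; set e6 := nu / 2 * _; lra.
Qed.

End ThetaBasis.

Section ThetaBasisBounds.
Context {R : realType}.
Variables (nu alpha : R).
Hypothesis nu_gt0 : 0 < nu.
Implicit Types (z w : R[i]) (n : int).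
Local Notation psi := (fock_basis nu alpha).

(** The remainder bound at [z] costs a factor exponential in [|n|], which
[fock_basis_dom] absorbs; what matters is that the constants are summable. *)
Lemma fock_basis_quad_diff z : exists kappa : int -> R, exists C : R,
  forall n, quad_diff (kappa n) (psi n) z /\ kappa n <= C * 2^-1 ^+ `|n|.
Proof.
pose L n := normc (2 * (nu / 2)%:C * z + (2 * pi * (n%:~R + alpha))%:C * 'i%C)
  + normc (nu / 2)%:C.
pose L0 := nu * normc z + 2 * pi * `|alpha| + nu / 2.
have pi0 : (0 : R) < pi := pi_gt0 R.
have L_ge0 n : 0 <= L n by rewrite addr_ge0 ?normc_ge0.
have LL0 n : L n <= L0 + 2 * pi * `|n%:~R|.
  have nu2 : normc (nu / 2)%:C = nu / 2 by rewrite normc_real gtr0_norm// divr_gt0.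
  have h1 : normc (2 * (nu / 2)%:C * z) = nu * normc z.
    rewrite normcM; congr (_ * _).
    have -> : 2 * (nu / 2)%:C = nu%:C.
      by rewrite -(realc_nat 2) -realcM; congr _%:C; field.
    by rewrite normc_real gtr0_norm.
  have h2 : normc ((2 * pi * (n%:~R + alpha))%:C * 'i%C) <=
      2 * pi * (`|n%:~R| + `|alpha|).
    rewrite normcM normc_real /= expr0n expr1n add0r sqrtr1 mulr1.
    rewrite normrM [`|2 * pi|]gtr0_norm ?mulr_gt0//.
    by rewrite ler_wpM2l ?ler_normD// mulr_ge0 ?ltW.
  have := le_normcD (2 * (nu / 2)%:C * z) ((2 * pi * (n%:~R + alpha))%:C * 'i%C).
  by rewrite /L /L0 nu2 h1; lra.
have [C [C0 HC]] := @fock_basis_dom _ nu alpha nu_gt0 _ (4 * pi) (normc_ge0 z)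
  (mulr_ge0 (ler0n _ 4) (ltW pi0)).
exists (fun n => normc (psi n z) * (4 * expR (L n) * L n ^+ 2 + nu / 2)).
exists (C * ((8 + nu / 2) * expR (2 * L0))) => n; split.
  have := quad_diffZ ((2 * nu / pi) `^ 4^-1)%:C (cexp_quad_diff (nu / 2)%:C
    ((2 * pi * (n%:~R + alpha))%:C * 'i%C)
    ((- (pi ^+ 2 / nu * (n%:~R + alpha) ^+ 2))%:C) z).
  rewrite mulrA -normcM -fock_basisE -/(L n).
  rewrite [normc (nu / 2)%:C]normc_real [`|nu / 2|]gtr0_norm ?divr_gt0//.
  by under [X in quad_diff _ X]funext do rewrite -fock_basisE.
have e1 : 4 * expR (L n) * L n ^+ 2 <= 8 * expR (2 * L n).
  have : L n ^+ 2 <= 2 * expR (L n).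
    by have := expR_ge1Dxn 1 (L_ge0 n); rewrite !factS fact0; lra.
  have -> : expR (2 * L n) = expR (L n) * expR (L n).
    by rewrite -expRD; congr expR; ring.
  by move=> /(ler_wpM2l (expR_ge0 (L n))); lra.
have e2 : nu / 2 <= nu / 2 * expR (2 * L n).
  rewrite ler_peMr ?(divr_ge0 (ltW nu_gt0))// (le_trans _ (expR_ge1Dx _))//.
  by rewrite lerDl mulr_ge0.
have e3 : expR (2 * L n) <= expR (2 * L0) * expR (4 * pi * `|n%:~R|).
  by rewrite -expRD ler_expR; have := LL0 n; lra.
rewrite (le_trans (y := normc (psi n z) * expR (4 * pi * `|n%:~R|) *
  ((8 + nu / 2) * expR (2 * L0))))//.
  rewrite -[leRHS]mulrA ler_wpM2l ?normc_ge0//.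
  rewrite (le_trans (lerD e1 e2))// -mulrDl mulrCA ler_wpM2l//.
    by rewrite addr_ge0// divr_ge0// ltW.
  by rewrite [leRHS]mulrC.
rewrite [leRHS]mulrAC ler_wpM2r ?HC//.
by rewrite mulr_ge0 ?expR_ge0// addr_ge0// divr_ge0// ltW.
Qed.

Lemma entire_fock_basis n : entire (psi n).
Proof.
move=> z; have [kappa [C H]] := fock_basis_quad_diff z.
exact: quad_diff_derivable (H n).1.
Qed.

(** The inverse is the exponential of the opposite polynomial. *)
Lemma entire_fock_basisV n : entire (fun z => (psi n z)^-1).
Proof.
have -> : (fun z => (psi n z)^-1) = fun z => (((2 * nu / pi) `^ 4^-1)%:C)^-1 *
   cexp ((- (nu / 2)%:C) * z ^+ 2 + (- ((2 * pi * (n%:~R + alpha))%:C * 'i%C)) * z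
         + (pi ^+ 2 / nu * (n%:~R + alpha) ^+ 2)%:C).
  apply/funext => z; rewrite fock_basisE invfM -cexpN; congr (_ * cexp _).
  by rewrite [(- _)%:C]rmorphN; ring.
move=> z; apply: quad_diff_derivable; apply: quad_diffZ.
exact: cexp_quad_diff.
Qed.

Lemma cexp_2ipi_int (m : int) : cexp (2 * 'i%C * pi%:C * m%:~R) = 1 :> R[i].
Proof.
have h (k : nat) : cexp (2 * 'i%C * pi%:C * k%:R) = 1 :> R[i].
  elim: k => [|k IH]; first by rewrite mulr0 cexp0.
  rewrite -(natr1 k) mulrDr cexpD IH mul1r mulr1.
  rewrite (_ : 2 * 'i%C * pi%:C = 0 +i* (pi *+ 2)).
    by rewrite cexpE /= expR0 cos2pi sin2pi; simpc.
  by rewrite mulrC mulrA mulr_natr -rmorphMn/= complexiE; simpc.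
case: m => k; first exact: h.
by rewrite NegzE mulrNz mulrN cexpN -pmulrn h invr1.
Qed.

Lemma quasi_periodic_fock_basis n : quasi_periodic nu alpha (psi n).
Proof.
move=> z m; rewrite /fock_basis; set c := (_ `^ _)%:C.
have rot (a b e1 e2 : R[i]) : a * b * (c * e1 * e2) = c * (a * (b * (e1 * e2))).
  by ring.
rewrite rot -mulrA; congr (_ * _); rewrite -!cexpD.
have -> : (nu / 2)%:C = nu%:C / 2 :> R[i] by rewrite realcM realcV realc_nat.
set A := (pi ^+ 2 / nu)%:C; set t := (n%:~R + alpha%:C) ^+ 2.
have -> : nu%:C / 2 * (z + m%:~R) ^+ 2 +
    (- A * t + 2 * 'i%C * pi%:C * (alpha%:C + n%:~R) * (z + m%:~R)) =
  (2 * 'i%C * pi%:C * alpha%:C * m%:~R + (nu%:C * (z + m%:~R / 2) * m%:~R +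
  (nu%:C / 2 * z ^+ 2 + (- A * t + 2 * 'i%C * pi%:C * (alpha%:C + n%:~R) * z))))
  + 2 * 'i%C * pi%:C * (n * m)%:~R.
  by clearbody A t; rewrite intrM; field.
by rewrite [LHS]cexpD cexp_2ipi_int mulr1.
Qed.

Lemma normc_fock_basis_dom (r : R) : 0 <= r ->
  exists C, 0 <= C /\ forall n z, normc z <= r -> normc (psi n z) <= C * 2^-1 ^+ `|n|.
Proof.
move=> r0; have [C [C0 HC]] := @fock_basis_dom _ nu alpha nu_gt0 _ 0 r0 (lexx _).
exists C; split=> // n z zr; have := HC n z zr.
by rewrite mul0r expR0 mulr1.
Qed.

(** Multiplying the exponentials, [psi n z] times the conjugate of [psi n w] is the
[n]th term of the theta series at [z - w^*], times the prefactor of the kernel. *)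
Lemma clim_fock_kernel z w :
  clim (fun N => \sum_(n <- zwindow N) ((psi n w)^*)%C * psi n z)
       (fock_kernel nu alpha z w).
Proof.
set t := fun n : int => n%:~R + alpha.
have eK n : ((psi n w)^*)%C * psi n z =
    ((2 * nu / pi) `^ 2^-1)%:C * cexp ((nu / 2)%:C * (z ^+ 2 + (w^*)%C ^+ 2)) *
    cexp ('i%C * pi%:C * (n%:~R + alpha%:C) ^+ 2 * (2 * 'i%C * pi%:C / nu%:C)
          + 2 * 'i%C * pi%:C * (n%:~R + alpha%:C) * (z - (w^*)%C + 0%:C)).
  rewrite !fock_basisE conjcM conjc_realC conj_cexp mulrACA.
  rewrite -realcM.
  have -> : (2 * nu / pi) `^ 4^-1 * (2 * nu / pi) `^ 4^-1 = (2 * nu / pi) `^ 2^-1.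
    rewrite -powRD; first by congr (_ `^ _); field.
    by apply/implyP => _; rewrite gt_eqF// divr_gt0// ?mulr_gt0// pi_gt0.
  rewrite -[RHS]mulrA -!cexpD; congr (_ * cexp _).
  rewrite !conjcD !conjcM !conjc_realC real_intD -/(t n).
  set A := pi ^+ 2 / nu * t n ^+ 2.
  have iE : 'i%C ^+ 2 = -1 :> R[i] := sqr_i R.
  have -> : 'i%C * pi%:C * (t n)%:C ^+ 2 * (2 * 'i%C * pi%:C / nu%:C) =
     - 2 * A%:C.
    transitivity ('i%C ^+ 2 * (2 * A%:C)); last by rewrite iE; ring.
    rewrite /A !(realcM, realcX, realcV); ring.
  have -> : (('i%C)^*)%C = - 'i%C :> R[i] by rewrite /=; simpc.
  rewrite realcN; set c := (w^*)%C.
  have -> : (2 * pi * t n)%:C = 2 * pi%:C * (t n)%:C :> R[i].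
    by rewrite !realcM realc_nat.
  by rewrite [0%:C](_ : _ = 0)//; ring.
have [C [C0 HC]] := normc_fock_basis_dom (normc_ge0 z).
have [C' [C0' HC']] := normc_fock_basis_dom (normc_ge0 w).
pose k := ((2 * nu / pi) `^ 2^-1)%:C * cexp ((nu / 2)%:C * (z ^+ 2 + (w^*)%C ^+ 2)).
have k0 : k != 0.
  rewrite mulf_neq0 ?cexp_neq0// -normc_gt0 normc_real normr_gt0 gt_eqF//.
  by rewrite powR_gt0// divr_gt0 ?pi_gt0// mulr_gt0.
rewrite /fock_kernel -/k; under eq_fun => N do
  (under eq_bigr => n _ do rewrite eK -/k; rewrite -mulr_sumr).
apply/climZ/(@clim_zsum _ _ (normc k^-1 * (C * C'))) => n.
rewrite -[cexp _](mulKf k0) -eK normcM -mulrA ler_wpM2l ?normc_ge0//.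
rewrite normcM normc_conj mulrC.
rewrite (le_trans (ler_pM _ _ (HC n z (lexx _)) (HC' n w (lexx _)))) ?normc_ge0//.
rewrite mulrACA -!mulrA !ler_wpM2l// ler_piMr ?exprn_ge0 ?invr_ge0//.
by rewrite exprn_ile1 ?invr_ge0// invf_le1// ler1n.
Qed.

End ThetaBasisBounds.

(** * Semi-inner products: Cauchy-Schwarz and Bessel *)

Section SemiInnerProducts.
Context {R : realType} {V : lmodType R[i]}.
Variables (H : set V) (dot : V -> V -> R[i]).
Implicit Types (u v w : V) (a c : R[i]).

(** Definiteness is left out: for continuous functions on the unit interval it
would fail away from the interval, and in the theta space it is a consequence of
the pointwise bound, which itself needs Cauchy-Schwarz. *)
Definition semi_inner_product : Prop :=
  [/\ linear_subspace H,
      forall a u v w, H u -> H v -> H w ->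
        dot (a *: u + v) w = a * dot u w + dot v w,
      forall u v, H u -> H v -> dot v u = ((dot u v)^*)%C
    & forall u, H u -> 0 <= dot u u].

Hypothesis sip : semi_inner_product.

Let H0 : H 0. Proof. by case: sip => -[]. Qed.

Let HZD a u v : H u -> H v -> H (a *: u + v).
Proof. by case: sip => -[_ h] _ _ _; exact: h. Qed.

Lemma sip_memZ a u : H u -> H (a *: u).
Proof. by move=> Hu; rewrite -[_ *: _]addr0; exact: HZD. Qed.

Lemma sip_memD u v : H u -> H v -> H (u + v).
Proof. by move=> Hu Hv; rewrite -[u]scale1r; exact: HZD. Qed.

Lemma sip_memB u v : H u -> H v -> H (u - v).
Proof. by move=> Hu Hv; rewrite addrC -scaleN1r; exact: HZD. Qed.

Lemma sip_mem_sum (I : Type) (s : seq I) (e : I -> V) :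
  (forall i, H (e i)) -> H (\sum_(i <- s) e i).
Proof. by move=> He; apply: big_ind => // u v; exact: sip_memD. Qed.

Let dotl a u v w : H u -> H v -> H w ->
  dot (a *: u + v) w = a * dot u w + dot v w.
Proof. by case: sip => _ h _ _; exact: h. Qed.

Lemma sipC u v : H u -> H v -> dot v u = ((dot u v)^*)%C.
Proof. by case: sip => _ _ h _; exact: h. Qed.

Lemma sipDl u v w : H u -> H v -> H w -> dot (u + v) w = dot u w + dot v w.
Proof. by move=> *; rewrite -{1}[u]scale1r dotl// mul1r. Qed.

Lemma sip0l w : H w -> dot 0 w = 0.
Proof.
by move=> Hw; apply: (addrI (dot 0 w)); rewrite addr0 -sipDl// addr0.
Qed.

Lemma sipZl a u w : H u -> H w -> dot (a *: u) w = a * dot u w.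
Proof. by move=> *; rewrite -[a *: u]addr0 dotl// sip0l// addr0. Qed.

Lemma sipBl u v w : H u -> H v -> H w -> dot (u - v) w = dot u w - dot v w.
Proof. by move=> *; rewrite addrC -scaleN1r dotl// mulN1r addrC. Qed.

Lemma sip_suml (I : Type) (s : seq I) (c : I -> R[i]) (e : I -> V) w :
  (forall i, H (e i)) -> H w ->
  dot (\sum_(i <- s) c i *: e i) w = \sum_(i <- s) c i * dot (e i) w.
Proof.
move=> He Hw; elim: s => [|i s IH]; first by rewrite !big_nil sip0l.
rewrite !big_cons dotl ?IH//; apply: sip_mem_sum => j; exact: sip_memZ.
Qed.

Lemma sipZr a u w : H u -> H w -> dot u (a *: w) = (a^*)%C * dot u w.
Proof.
move=> Hu Hw; rewrite sipC//; last exact: sip_memZ.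
by rewrite sipZl// conjcM -sipC.
Qed.

Lemma sipBr u v w : H u -> H v -> H w -> dot w (u - v) = dot w u - dot w v.
Proof.
move=> Hu Hv Hw; rewrite sipC//; last exact: sip_memB.
by rewrite sipBl// conjcD conjcN -!sipC.
Qed.

Lemma sip_norm_sqr u : H u -> dot u u = (dot_norm dot u ^+ 2)%:C.
Proof.
move=> Hu; case: sip => _ _ _ /(_ u Hu); rewrite /dot_norm.
by case: (dot u u) => a b; rewrite lecE /= => /andP[/eqP-> a0]; rewrite sqr_sqrtr.
Qed.

Lemma dot_norm_ge0 u : 0 <= dot_norm dot u.
Proof. exact: sqrtr_ge0. Qed.

(** Cauchy-Schwarz: [dot] is nonnegative at [u - t c v], a quadratic
polynomial in the real number [t] when [c = dot u v]. *)
Lemma sip_CauchySchwarz u v : H u -> H v ->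
  normc (dot u v) <= dot_norm dot u * dot_norm dot v.
Proof.
move=> Hu Hv; set c := dot u v.
have nu0 := dot_norm_ge0 u; have nv0 := dot_norm_ge0 v.
rewrite -(ler_pXn2r (_ : 0 < 2)%N) ?nnegrE ?normc_ge0 ?mulr_ge0// exprMn.
set A := normc c ^+ 2; set N := dot_norm dot v ^+ 2; set M := dot_norm dot u ^+ 2.
have A0 : 0 <= A by exact: sqr_ge0.
have N0 : 0 <= N by exact: sqr_ge0.
have M0 : 0 <= M by exact: sqr_ge0.
have key (t : R) : 0 <= M - 2 * t * A + t ^+ 2 * A * N.
  have Hw : H (u - (t%:C * c) *: v) by apply: sip_memB => //; exact: sip_memZ.
  have Hcv : H ((t%:C * c) *: v) by exact: sip_memZ.
  have : 0 <= dot (u - (t%:C * c) *: v) (u - (t%:C * c) *: v).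
    by case: sip => _ _ _; apply.
  rewrite sipBl// !sipBr// !sipZl// !sipZr// !sip_norm_sqr// (sipC Hu Hv) -/c.
  rewrite conjcM conjc_realC -/M -/N.
  have cc : c * (c^*)%C = A%:C by exact: mul_conjc.
  have -> : M%:C - t%:C * (c^*)%C * c
      - (t%:C * c * (c^*)%C - t%:C * c * (t%:C * (c^*)%C * N%:C)) =
      M%:C - 2 * t%:C * (c * (c^*)%C) + t%:C ^+ 2 * (c * (c^*)%C) * N%:C.
    by ring.
  by rewrite cc -(realc_nat 2) -!realcX -!realcM -realcN -!realcD -lecR.
have [A00|A1] := eqVneq A 0; first by rewrite A00 mulr_ge0.
have {}A0 : 0 < A by rewrite lt_def A1.
have [N00|N1] := eqVneq N 0.
  have := key ((M + 1) / (2 * A)); rewrite N00 mulr0 addr0.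
  have -> : 2 * ((M + 1) / (2 * A)) * A = M + 1 by field.
  lra.
have {}N0 : 0 < N by rewrite lt_def N1.
have := key N^-1; rewrite -(ler_pM2r N0) mul0r.
have -> : (M - 2 * N^-1 * A + N^-1 ^+ 2 * A * N) * N = M * N - A by field.
by rewrite subr_ge0.
Qed.

Section Orthonormal.
Variables (I : eqType) (e : I -> V).
Hypothesis He : forall i, H (e i).
Hypothesis e_orthonormal : forall i j, dot (e i) (e j) = (i == j)%:R.

Lemma sip_sum_coef (s : seq I) (c : I -> R[i]) (j : I) : uniq s -> j \in s ->
  dot (\sum_(i <- s) c i *: e i) (e j) = c j.
Proof.
move=> us js; rewrite sip_suml//; under eq_bigr do rewrite e_orthonormal.
rewrite (bigD1_seq j)//= eqxx mulr1 big1 ?addr0// => i /negPf->.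
by rewrite mulr0.
Qed.

Lemma sip_norm_sum (s : seq I) (c : I -> R[i]) : uniq s ->
  dot_norm dot (\sum_(i <- s) c i *: e i) ^+ 2 = \sum_(i <- s) normc (c i) ^+ 2.
Proof.
move=> us; set v := \sum_(i <- s) _.
have Hv : H v by apply: sip_mem_sum => i; exact: sip_memZ.
apply: (@complexI R); rewrite -sip_norm_sqr// {1}/v sip_suml// rmorph_sum/=.
rewrite !big_seq; apply: eq_bigr => i si.
by rewrite sipC// sip_sum_coef// mul_conjc.
Qed.

(** Bessel's inequality, which is Cauchy-Schwarz for [u] and its projection. *)
Lemma sip_Bessel (s : seq I) u : uniq s -> H u ->
  \sum_(i <- s) normc (dot u (e i)) ^+ 2 <= dot_norm dot u ^+ 2.
Proof.
move=> us Hu; set c := fun i => dot u (e i).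
set v := \sum_(i <- s) c i *: e i.
have Hv : H v by apply: sip_mem_sum => i; exact: sip_memZ.
have nv := sip_norm_sum c us; rewrite -/v in nv.
have vu : dot v u = (dot_norm dot v ^+ 2)%:C.
  rewrite nv /v sip_suml// rmorph_sum/=; apply: eq_bigr => i _.
  by rewrite (sipC Hu)// mul_conjc.
have := sip_CauchySchwarz Hv Hu.
rewrite vu normc_real ger0_norm ?sqr_ge0// -nv expr2.
have := dot_norm_ge0 v; have := dot_norm_ge0 u.
have [->|v0] := eqVneq (dot_norm dot v) 0; first by rewrite mulr0 sqr_ge0.
move=> u0 v0'; have vp : 0 < dot_norm dot v by rewrite lt_def v0.
rewrite ler_pM2l// => vu'; nra.
Qed.

End Orthonormal.
End SemiInnerProducts.

(** * Integrals of complex functions *)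

Section ComplexIntegral.
Context d {T : measurableType d} {R : realType}.
Variables (mu : {measure set T -> \bar R}) (D : set T).
Hypothesis mD : measurable D.
Implicit Types (F G : T -> R[i]) (a : R[i]).

Definition cmeasurable F :=
  measurable_fun D (@complex.Re R \o F) /\ measurable_fun D (@complex.Im R \o F).

Definition cintegrable F :=
  mu.-integrable D (EFin \o (@complex.Re R \o F)) /\
  mu.-integrable D (EFin \o (@complex.Im R \o F)).

Definition cintegral F : R[i] :=
  (\int[mu]_(t in D) complex.Re (F t)) +i* (\int[mu]_(t in D) complex.Im (F t)).

Lemma cmeasurableM F G :
  cmeasurable F -> cmeasurable G -> cmeasurable (fun t => F t * G t).
Proof.
move=> [F1 F2] [G1 G2]; split.
  apply: (@eq_measurable_fun _ _ _ _ D ((@complex.Re R \o F) \* (@complex.Re R \o G)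
      \- (@complex.Im R \o F) \* (@complex.Im R \o G))).
    by move=> t _ /=; case: (F t) (G t) => [x y] [x' y'].
  by apply: measurable_funB; apply: measurable_funM.
apply: (@eq_measurable_fun _ _ _ _ D ((@complex.Re R \o F) \* (@complex.Im R \o G)
      \+ (@complex.Im R \o F) \* (@complex.Re R \o G))).
  by move=> t _ /=; case: (F t) (G t) => [x y] [x' y'].
by apply: measurable_funD; apply: measurable_funM.
Qed.

Lemma cmeasurable_conj F :
  cmeasurable F -> cmeasurable (fun t => ((F t)^*)%C).
Proof.
move=> [F1 F2]; split.
  by apply: eq_measurable_fun F1 => t _ /=; case: (F t).
apply: (@eq_measurable_fun _ _ _ _ D (\- (@complex.Im R \o F))).
  by move=> t _ /=; case: (F t).
exact: measurableT_comp.
Qed.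

Lemma cmeasurable_normc F :
  cmeasurable F -> measurable_fun D (fun t => normc (F t) ^+ 2).
Proof.
move=> [F1 F2]; under eq_fun do rewrite normc_sqr.
by apply: measurable_funD; apply: measurable_funX.
Qed.

Lemma cintegrable_dom F (g : T -> R) : cmeasurable F ->
  (forall t, D t -> normc (F t) <= g t) -> mu.-integrable D (EFin \o g) ->
  cintegrable F.
Proof.
move=> [F1 F2] Fg ig; split; apply: le_integrable ig => //.
- exact/measurable_EFinP.
- move=> t Dt; rewrite /= lee_fin (le_trans (normc_Re _))//.
  by rewrite (le_trans (Fg _ Dt))// ler_norm.
- exact/measurable_EFinP.
- move=> t Dt; rewrite /= lee_fin (le_trans (normc_Im _))//.
  by rewrite (le_trans (Fg _ Dt))// ler_norm.
Qed.

Lemma eq_cintegral F G : (forall t, D t -> F t = G t) -> cintegral F = cintegral G.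
Proof.
by move=> FG; congr (_ +i* _); apply: eq_Rintegral => t /set_mem /FG ->.
Qed.

Lemma cintegralZD a F G : cintegrable F -> cintegrable G ->
  cintegral (fun t => a * F t + G t) = a * cintegral F + cintegral G.
Proof.
case: a => x y [F1 F2] [G1 G2]; rewrite /cintegral; simpc; congr (_ +i* _).
  rewrite (@eq_Rintegral _ _ _ mu D (fun t => (x * complex.Re (F t)
     + (- y) * complex.Im (F t)) + complex.Re (G t))); last first.
    by move=> t _; case: (F t) (G t) => [x1 y1] [x2 y2] /=; ring.
  rewrite RintegralD//; last first.
    rewrite (_ : EFin \o _ = (fun t => x%:E * (EFin \o (@complex.Re R \o F)) t
      + (- y)%:E * (EFin \o (@complex.Im R \o F)) t)%E)//.
    by apply: integrableD => //; exact: integrableZl.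
  rewrite RintegralD// ?RintegralZl//; last 2 first.
  - exact: (integrableZl mD _ F1).
  - exact: (integrableZl mD _ F2).
  by rewrite mulNr.
rewrite (@eq_Rintegral _ _ _ mu D (fun t => (x * complex.Im (F t)
     + y * complex.Re (F t)) + complex.Im (G t))); last first.
  by move=> t _; case: (F t) (G t) => [x1 y1] [x2 y2] /=; ring.
rewrite RintegralD//; last first.
  rewrite (_ : EFin \o _ = (fun t => x%:E * (EFin \o (@complex.Im R \o F)) t
      + y%:E * (EFin \o (@complex.Re R \o F)) t)%E)//.
  by apply: integrableD => //; exact: integrableZl.
rewrite RintegralD// ?RintegralZl//.
- exact: (integrableZl mD _ F2).
- exact: (integrableZl mD _ F1).
Qed.

Lemma cintegrable0 : cintegrable (fun=> 0).
Proof. by split; exact: integrable0. Qed.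

Lemma cintegral0 : cintegral (fun=> 0) = 0.
Proof. by rewrite /cintegral /= /Rintegral integral0. Qed.

Lemma cintegralZ a F : cintegrable F ->
  cintegral (fun t => a * F t) = a * cintegral F.
Proof.
move=> iF; rewrite -[RHS]addr0 -cintegral0 -cintegralZD//; last exact: cintegrable0.
by under [in RHS]eq_cintegral do rewrite addr0.
Qed.

Lemma cintegral_conj F : cintegrable F ->
  cintegral (fun t => ((F t)^*)%C) = ((cintegral F)^*)%C.
Proof.
move=> [F1 F2]; rewrite /cintegral /=; congr (_ +i* _).
  by apply: eq_Rintegral => t _; case: (F t).
rewrite -mulN1r -RintegralZl//; apply: eq_Rintegral => t _; case: (F t) => x y /=.
by rewrite mulN1r.
Qed.

(** The form pulled back from [L^2] along a linear map [phi] into functions. *)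
Lemma cintegral_semi_inner_product (V : lmodType R[i]) (H : set V)
    (phi : V -> T -> R[i]) :
  linear_subspace H ->
  (forall a u v t, phi (a *: u + v) t = a * phi u t + phi v t) ->
  (forall u v, H u -> H v -> cintegrable (fun t => phi u t * ((phi v t)^*)%C)) ->
  semi_inner_product H (fun u v => cintegral (fun t => phi u t * ((phi v t)^*)%C)).
Proof.
move=> HS lphi iphi; split=> //.
- move=> a u v w Hu Hv Hw; rewrite -cintegralZD; [|exact: iphi..].
  by apply: eq_cintegral => t _; rewrite lphi mulrDl mulrA.
- move=> u v Hu Hv; rewrite -cintegral_conj; last exact: iphi.
  by apply: eq_cintegral => t _; rewrite conjcM conjcK mulrC.
- move=> u Hu; rewrite (eq_cintegral (G := fun t => (normc (phi u t) ^+ 2)%:C)).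
    rewrite /cintegral /= /Rintegral integral0 lecE /= eqxx/=.
    by apply: fine_ge0; apply: integral_ge0 => t _; rewrite lee_fin sqr_ge0.
  by move=> t _; exact: mul_conjc.
Qed.

End ComplexIntegral.

Section UnitInterval.
Context {R : realType}.
Local Notation mu := (@lebesgue_measure R).
Local Notation unit01 := (`[0%R, 1%R]%classic : set (measurableTypeR R)).

Definition ccontinuous (F : R -> R[i]) :=
  continuous (@complex.Re R \o F) /\ continuous (@complex.Im R \o F).

Lemma ccontinuousM F G :
  ccontinuous F -> ccontinuous G -> ccontinuous (fun t => F t * G t).
Proof.
move=> [F1 F2] [G1 G2]; split.
  rewrite (_ : _ \o _ = ((@complex.Re R \o F) \* (@complex.Re R \o G)
      \- (@complex.Im R \o F) \* (@complex.Im R \o G))); last first.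
    by apply/funext => t /=; case: (F t) (G t) => [x y] [x' y'].
  by move=> t; apply: cvgB; apply: cvgM; [exact: F1|exact: G1|exact: F2|exact: G2].
rewrite (_ : _ \o _ = ((@complex.Re R \o F) \* (@complex.Im R \o G)
      \+ (@complex.Im R \o F) \* (@complex.Re R \o G))); last first.
  by apply/funext => t /=; case: (F t) (G t) => [x y] [x' y'].
by move=> t; apply: cvgD; apply: cvgM; [exact: F1|exact: G2|exact: F2|exact: G1].
Qed.

Lemma ccontinuous_conj F : ccontinuous F -> ccontinuous (fun t => ((F t)^*)%C).
Proof.
move=> [F1 F2]; split.
  rewrite (_ : _ \o _ = @complex.Re R \o F)//.
  by apply/funext => t /=; case: (F t).
rewrite (_ : _ \o _ = \- (@complex.Im R \o F)).
  by move=> t; apply: cvgN; exact: F2.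
by apply/funext => t /=; case: (F t).
Qed.

Lemma ccontinuousZD a F G :
  ccontinuous F -> ccontinuous G -> ccontinuous (fun t => a * F t + G t).
Proof.
move=> cF [G1 G2].
have [|A1 A2] := @ccontinuousM (fun=> a) F _ cF.
  by split=> t; exact: cvg_cst.
split.
  rewrite (_ : _ \o _ = (@complex.Re R \o (fun t => a * F t)) \+ (@complex.Re R \o G)).
    by move=> t; apply: cvgD; [exact: A1|exact: G1].
  by apply/funext => t; rewrite /= raddfD.
rewrite (_ : _ \o _ = (@complex.Im R \o (fun t => a * F t)) \+ (@complex.Im R \o G)).
  by move=> t; apply: cvgD; [exact: A2|exact: G2].
by apply/funext => t; rewrite /= raddfD.
Qed.

Lemma continuous_itv_integrable (f : R -> R) (a b : R) : continuous f ->
  mu.-integrable `[a, b] (EFin \o f).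
Proof.
move=> cf; apply: continuous_compact_integrable; first exact: segment_compact.
exact: continuous_subspaceT.
Qed.

Lemma ccontinuous_integrable F : ccontinuous F -> cintegrable mu unit01 F.
Proof. by move=> [F1 F2]; split; exact: continuous_itv_integrable. Qed.

Definition mean01 (F : R -> R[i]) : R[i] := cintegral mu unit01 F.

Lemma mean01ZD a F G : ccontinuous F -> ccontinuous G ->
  mean01 (fun x => a * F x + G x) = a * mean01 F + mean01 G.
Proof. by move=> cF cG; apply: cintegralZD => //; exact: ccontinuous_integrable. Qed.

Lemma mean01Z a F : ccontinuous F -> mean01 (fun x => a * F x) = a * mean01 F.
Proof. by move=> cF; apply: cintegralZ => //; exact: ccontinuous_integrable. Qed.

Definition dot01 (F G : R -> R[i]) : R[i] := mean01 (fun x => F x * ((G x)^*)%C).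

Lemma semi_inner_product01 : semi_inner_product ccontinuous dot01.
Proof.
apply: (@cintegral_semi_inner_product _ _ _ mu unit01 _ _ _ (fun F => F)) => //.
- split; first by split=> t; exact: cvg_cst.
  by move=> a u v; exact: ccontinuousZD.
- move=> F G cF cG; apply: ccontinuous_integrable; apply: ccontinuousM => //.
  exact: ccontinuous_conj.
Qed.

End UnitInterval.

(** * Goursat's theorem on rectangles *)

Section Goursat.
Context {R : realType}.
Local Notation mu := (@lebesgue_measure R).
Implicit Types (f g : R -> R) (a b c x y w h e : R).

Definition segint f a b : R := \int[mu]_(x in `[a, b]) f x.

Lemma segint_split f a b c : continuous f -> a <= b -> b <= c ->
  segint f a c = segint f a b + segint f b c.
Proof.
move=> cf ab bc; rewrite /segint.
have hi : mu.-integrable `[a, c] (EFin \o f) by exact: continuous_itv_integrable.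
have := @Rintegral_itvB R f (BLeft a) (BRight c) b.
rewrite Rintegral_itv_obnd_cbnd; last first.
  apply: integrableS hi => //; apply: subset_itvr; exact: ab.
move=> h; have {}h := h hi ab bc; rewrite -[X in _ = _ + X]h; ring.
Qed.

Lemma segint_near f a b m e : continuous f -> a <= b ->
  (forall x, a <= x <= b -> `|f x - m| <= e) ->
  `|segint f a b - m * (b - a)| <= e * (b - a).
Proof.
move=> cf ab fm; rewrite /segint.
have cstE (r : R) : \int[mu]_(x in `[a, b]) r = r * (b - a).
  rewrite Rintegral_cst//= lebesgue_measure_itv /= lte_fin.
  by move: ab; rewrite le_eqVlt => /orP[/eqP->|->]; rewrite ?ltxx ?subrr ?mulr0.
have ic (r : R) : mu.-integrable `[a, b] (EFin \o cst r).
  by apply: continuous_itv_integrable => x; exact: cvg_cst.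
have hi := continuous_itv_integrable a b cf.
rewrite ler_distl -!mulrBl -!mulrDl -!cstE; apply/andP; split.
  apply: le_Rintegral => //; first exact: ic.
  by move=> x; rewrite /= in_itv /= => /fm; rewrite ler_distl => /andP[].
apply: le_Rintegral => //; first exact: ic.
by move=> x; rewrite /= in_itv /= => /fm; rewrite ler_distl => /andP[].
Qed.

Lemma segintB f g a b : continuous f -> continuous g ->
  segint (fun x => f x - g x) a b = segint f a b - segint g a b.
Proof.
by move=> cf cg; apply: RintegralB => //; exact: continuous_itv_integrable.
Qed.

Lemma nested_segments (a w : nat -> R) : (forall k, 0 <= w k) ->
  (forall k, a k <= a k.+1) -> (forall k, a k.+1 + w k.+1 <= a k + w k) ->
  exists x, forall k, a k <= x <= a k + w k.
Proof.
move=> w0 ainc adec.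
have inc : nondecreasing_seq a by exact/nondecreasing_seqP.
have dec : nonincreasing_seq (fun k => a k + w k) by exact/nonincreasing_seqP.
have ub k m : a m <= a k + w k.
  have [km|/ltnW mk] := leqP k m.
    by rewrite (le_trans _ (dec _ _ km))// lerDl.
  by rewrite (le_trans (inc _ _ mk))// lerDl.
have ca : cvgn a.
  by apply: nondecreasing_is_cvgn => //; exists (a 0 + w 0) => _ [m _ <-].
exists (limn a) => k; rewrite nondecreasing_cvgn_le//=.
by apply: limr_le => //; apply: nearW => m; exact: ub.
Qed.

Variables (P Q : R -> R -> R).

(** Closedness of [P dx + Q dy] with no regularity of the derivatives, which is
what mere complex differentiability provides. The shared [p2] is
[dP/dy = dQ/dx]. *)
Definition closed_form := forall x y, exists p1 p2 q2, forall e, 0 < e ->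
  exists2 d : R, 0 < d & forall h k : R, `|h| < d -> `|k| < d ->
    `|P (x + h) (y + k) - P x y - p1 * h - p2 * k| <= e * (`|h| + `|k|) /\
    `|Q (x + h) (y + k) - Q x y - p2 * h - q2 * k| <= e * (`|h| + `|k|).

Definition rectint a c w h : R :=
  segint (P^~ c) a (a + w) - segint (P^~ (c + h)) a (a + w)
  + segint (Q (a + w)) c (c + h) - segint (Q a) c (c + h).

Hypothesis cP : forall y, continuous (P^~ y).
Hypothesis cQ : forall x, continuous (Q x).

Lemma rectint_quarters a c w h : 0 <= w -> 0 <= h ->
  rectint a c (w + w) (h + h) =
  rectint a c w h + rectint (a + w) c w h
  + rectint a (c + h) w h + rectint (a + w) (c + h) w h.
Proof.
move=> w0 h0; rewrite /rectint !addrA.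
have sP y : segint (P^~ y) a (a + w + w) =
    segint (P^~ y) a (a + w) + segint (P^~ y) (a + w) (a + w + w).
  by apply: segint_split; rewrite ?lerDl.
have sQ x : segint (Q x) c (c + h + h) =
    segint (Q x) c (c + h) + segint (Q x) (c + h) (c + h + h).
  by apply: segint_split; rewrite ?lerDl.
rewrite !sP !sQ; ring.
Qed.

(** The affine parts of [P] and [Q] at the point contribute
[- p2 * h * w + p2 * w * h = 0]; only the remainders are left. *)
Lemma rectint_small x y : closed_form ->
  forall e, 0 < e -> exists2 d : R, 0 < d & forall a c w h,
    a <= x <= a + w -> c <= y <= c + h -> w < d -> h < d ->
    `|rectint a c w h| <= 2 * e * (w + h) ^+ 2.
Proof.
move=> PQ e e0; have [p1 [p2 [q2 /(_ e e0)[d d0 dP]]]] := PQ x y.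
exists d => // a c w h /andP[ax xa] /andP[cy yc] wd hd.
have w0 : 0 <= w by lra.
have h0 : 0 <= h by lra.
have near_le (t t0 s r : R) : t0 <= t <= t0 + s -> t0 <= r <= t0 + s -> `|t - r| <= s.
  by move=> /andP[t1 t2] /andP[r1 r2]; rewrite ler_norml; apply/andP; split; lra.
have xx : a <= x <= a + w by rewrite ax.
have yy : c <= y <= c + h by rewrite cy.
have est t s : a <= t <= a + w -> c <= s <= c + h ->
    `|P t s - P x y - p1 * (t - x) - p2 * (s - y)| <= e * (w + h) /\
    `|Q t s - Q x y - p2 * (t - x) - q2 * (s - y)| <= e * (w + h).
  move=> tt ss; have tx := near_le _ _ _ _ tt xx; have sy := near_le _ _ _ _ ss yy.
  have [] := dP (t - x) (s - y) (le_lt_trans tx wd) (le_lt_trans sy hd).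
  rewrite !(addrC x) !(addrC y) !subrK => e1 e2.
  have b : e * (`|t - x| + `|s - y|) <= e * (w + h) by rewrite ler_wpM2l ?lerD// ltW.
  by split; apply: le_trans b.
have cc : c <= c <= c + h by rewrite lexx lerDl.
have ch : c <= c + h <= c + h by rewrite lexx lerDl h0.
have aa : a <= a <= a + w by rewrite lexx lerDl.
have aw : a <= a + w <= a + w by rewrite lexx lerDl w0.
have hP : `|segint (P^~ c) a (a + w) - segint (P^~ (c + h)) a (a + w) - - (p2 * h) * w|
    <= 2 * e * (w + h) * w.
  rewrite -segintB// -[X in _ * X](_ : a + w - a = w); last by ring.
  rewrite -[X in _ <= _ * X](_ : a + w - a = w); last by ring.
  apply: segint_near; rewrite ?lerDl//.
    by move=> t; apply: cvgB; exact: cP.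
  move=> t tt; have [e1 _] := est t c tt cc; have [e2 _] := est t (c + h) tt ch.
  have := le_trans (ler_normB _ _) (lerD e1 e2).
  by rewrite -!mulrA mulr_natl -mulr2n; congr (`| _ | <= _); ring.
have hQ : `|segint (Q (a + w)) c (c + h) - segint (Q a) c (c + h) - (p2 * w) * h|
    <= 2 * e * (w + h) * h.
  rewrite -segintB// -[X in _ * X](_ : c + h - c = h); last by ring.
  rewrite -[X in _ <= _ * X](_ : c + h - c = h); last by ring.
  apply: segint_near; rewrite ?lerDl//.
    by move=> t; apply: cvgB; exact: cQ.
  move=> t tt; have [_ e1] := est (a + w) t aw tt; have [_ e2] := est a t aa tt.
  have := le_trans (ler_normB _ _) (lerD e1 e2).
  by rewrite -!mulrA mulr_natl -mulr2n; congr (`| _ | <= _); ring.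
have := le_trans (ler_normD _ _) (lerD hP hQ).
rewrite /rectint expr2 mulrA -mulrDr; apply: le_trans.
by rewrite le_eqVlt; apply/orP; left; apply/eqP; congr `| _ |; ring.
Qed.

(** Goursat's bisection: were the integral nonzero, some quarter would carry at
least a quarter of it, and so on; at the limit point [rectint_small] fails. *)
Lemma Goursat_rectangle a c w h : closed_form -> 0 <= w -> 0 <= h ->
  rectint a c w h = 0.
Proof.
move=> PQ w0 h0; apply/eqP; apply: contraT => J0.
set J := rectint a c w h in J0.
pose W k : R := w / 2 ^+ k; pose H k : R := h / 2 ^+ k.
have p2 k : (0 : R) < 2 ^+ k by rewrite exprn_gt0.
have W0 k : 0 <= W k by rewrite divr_ge0// ltW.
have H0 k : 0 <= H k by rewrite divr_ge0// ltW.
have WS k : W k = W k.+1 + W k.+1 by rewrite /W exprS; field; rewrite gt_eqF.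
have HS k : H k = H k.+1 + H k.+1 by rewrite /H exprS; field; rewrite gt_eqF.
pose bad k (p : R * R) := `|J| <= 4 ^+ k * `|rectint p.1 p.2 (W k) (H k)|.
pose next k (p q : R * R) := [/\ bad k.+1 q, p.1 <= q.1, q.1 <= p.1 + W k.+1,
  p.2 <= q.2 & q.2 <= p.2 + H k.+1].
have step (kp : nat * (R * R)) : exists q, bad kp.1 kp.2 -> next kp.1 kp.2 q.
  case: kp => k [x y] /=; rewrite /bad /next /= WS HS rectint_quarters//.
  set w1 := W k.+1; set h1 := H k.+1.
  have w10 : 0 <= w1 by exact: W0.
  have h10 : 0 <= h1 by exact: H0.
  set r := rectint x y w1 h1; set r1 := rectint (x + w1) y w1 h1.
  set r2 := rectint x (y + h1) w1 h1; set r3 := rectint (x + w1) (y + h1) w1 h1.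
  have [b0|b0] := leP `|J| (4 ^+ k.+1 * `|r|).
    by exists (x, y) => _; split => //=; rewrite ?lexx// lerDl.
  have [b1|b1] := leP `|J| (4 ^+ k.+1 * `|r1|).
    by exists (x + w1, y) => _; split => //=; rewrite ?lexx// lerDl.
  have [b2|b2] := leP `|J| (4 ^+ k.+1 * `|r2|).
    by exists (x, y + h1) => _; split => //=; rewrite ?lexx// lerDl.
  have [b3|b3] := leP `|J| (4 ^+ k.+1 * `|r3|).
    by exists (x + w1, y + h1) => _; split => //=; rewrite ?lexx// lerDl.
  exists (x, y) => hb; exfalso; move: b0 b1 b2 b3 hb; rewrite exprS.
  have p4 : (0 : R) < 4 ^+ k by rewrite exprn_gt0.
  have n1 := ler_normD (r + r1 + r2) r3; have n2 := ler_normD (r + r1) r2.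
  have n3 := ler_normD r r1.
  have : 4 ^+ k * `|r + r1 + r2 + r3| <= 4 ^+ k * (`|r| + `|r1| + `|r2| + `|r3|).
    by rewrite ler_wpM2l ?(ltW p4)//; lra.
  by rewrite -!mulrA; move: (4 ^+ k) p4 => K K0; rewrite !mulrDr; lra.
have [F FP] := choice step.
pose s := fix s k := if k is k'.+1 then F (k', s k') else (a, c).
have sbad k : bad k (s k).
  elim: k => [|k IH]; last by have [] := FP (k, s k) IH.
  by rewrite /bad /s /= /W /H !expr0 !divr1 mul1r.
have sn k : next k (s k) (s k.+1) by exact: (FP (k, s k)).
have [x xP] : exists x, forall k, (s k).1 <= x <= (s k).1 + W k.
  apply: nested_segments => // k; have [_ h1 h2 _ _] := sn k => //.
  by rewrite [X in _ <= _ + X]WS addrA lerD2r.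
have [y yP] : exists y, forall k, (s k).2 <= y <= (s k).2 + H k.
  apply: nested_segments => // k; have [_ _ _ h1 h2] := sn k => //.
  by rewrite [X in _ <= _ + X]HS addrA lerD2r.
have J1 : 0 < `|J| by rewrite normr_gt0.
(* With this [e] the bound of [rectint_small], scaled back by [4 ^+ k], is below
[`|J|]. *)
pose e := `|J| / (4 * ((w + h) ^+ 2 + 1)).
have e0 : 0 < e by rewrite divr_gt0// mulr_gt0// ltr_wpDl// sqr_ge0.
have [d d0 dP] := rectint_small x y PQ e0.
have [k kP] : exists k : nat, w + h < d * 2 ^+ k.
  have := archi_boundP (divr_ge0 (addr_ge0 w0 h0) (ltW d0)).
  set k := Num.bound _ => kP; exists k; rewrite mulrC -ltr_pdivrMr//.
  by rewrite (lt_le_trans kP)// -natrX ler_nat ltnW// ltn_expl.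
have Wd : W k < d by rewrite ltr_pdivrMr//; lra.
have Hd : H k < d by rewrite ltr_pdivrMr//; lra.
have := dP _ _ _ _ (xP k) (yP k) Wd Hd => hr.
have : `|J| <= 4 ^+ k * (2 * e * (W k + H k) ^+ 2).
  by rewrite (le_trans (sbad k))// ler_wpM2l// exprn_ge0.
have -> : 4 ^+ k * (2 * e * (W k + H k) ^+ 2) = 2 * e * (w + h) ^+ 2.
  have -> : (4 : R) ^+ k = 2 ^+ k * 2 ^+ k by rewrite -exprMn; congr (_ ^+ _); ring.
  by rewrite /W /H; field; rewrite gt_eqF.
have : 4 * e * ((w + h) ^+ 2 + 1) = `|J|.
  by rewrite /e; field; rewrite gt_eqF// ltr_wpDl// sqr_ge0.
have := sqr_ge0 (w + h); set S := _ ^+ 2 => S0 eJ.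
rewrite -eJ; nra.
Qed.

End Goursat.

(** * Entire functions on lines and in the plane *)

Section EntireFunctions.
Context {R : realType}.
Local Notation mu := (@lebesgue_measure R).
Implicit Types (f g : R[i] -> R[i]) (z : R[i]) (x y : R).

Lemma entire_cst (a : R[i]) : entire (fun=> a).
Proof. by move=> z; exact: derivable_cst. Qed.

Lemma entireD f g : entire f -> entire g -> entire (fun z => f z + g z).
Proof. by move=> ef eg z; exact: (derivableD (ef z) (eg z)). Qed.

Lemma entireB f g : entire f -> entire g -> entire (fun z => f z - g z).
Proof. by move=> ef eg z; exact: (derivableB (ef z) (eg z)). Qed.

Lemma entireM f g : entire f -> entire g -> entire (fun z => f z * g z).
Proof. by move=> ef eg z; exact: (derivableM (ef z) (eg z)). Qed.

Lemma entire_near f : entire f -> forall z (e : R), 0 < e ->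
  exists2 d : R, 0 < d & forall h, normc h < d -> normc (f (z + h) - f z) <= e.
Proof.
move=> ef z e e0; have /derivable_has_cderiv[D /(_ 1 ltr01)[d d0 dP]] := ef z.
have n0 := normc_ge0 D; have p : 0 < normc D + 1 by lra.
exists (Num.min d (e / (normc D + 1))); first by rewrite lt_min d0 divr_gt0.
move=> h; rewrite lt_min ltr_pdivlMr// => /andP[/dP hd he].
rewrite -[_ - _](subrK (D * h)) (le_trans (le_normcD _ _))// normcM.
by move: hd; lra.
Qed.

Lemma ccontinuous_near (F : R -> R[i]) : (forall x (e : R), 0 < e ->
    exists2 d : R, 0 < d & forall h, `|h| < d -> normc (F (x + h) - F x) <= e) ->
  ccontinuous F.
Proof.
move=> FP; split=> x; apply/cvgrPdist_le => e e0; have [d d0 dP] := FP x e e0;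
  apply/nbhs_ballP; exists d => // t /=; rewrite distrC => xt;
  rewrite -raddfB; have := dP (t - x) xt; rewrite [x + _]addrC subrK normc_distrC;
  apply: le_trans; [exact: normc_Re|exact: normc_Im].
Qed.

Lemma entire_line_x f y : entire f -> ccontinuous (fun x => f (x +i* y)).
Proof.
move=> ef; apply: ccontinuous_near => x e e0.
have [d d0 dP] := entire_near ef (x +i* y) e0; exists d => // h hd.
by have := dP h%:C; rewrite normc_real => /(_ hd); simpc.
Qed.

Lemma entire_line_y f x : entire f -> ccontinuous (fun y => f (x +i* y)).
Proof.
move=> ef; apply: ccontinuous_near => y e e0.
have [d d0 dP] := entire_near ef (x +i* y) e0; exists d => // h hd.
have nh : normc (0 +i* h) = `|h| by rewrite /= expr0n add0r sqrtr_sqr.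
by have := dP (0 +i* h); rewrite nh => /(_ hd); simpc.
Qed.

(** The Cauchy-Riemann equations, as closedness of the real and imaginary parts
of [f dz]. *)
Lemma entire_closed_form f : entire f ->
  closed_form (fun x y => complex.Re (f (x +i* y)))
              (fun x y => - complex.Im (f (x +i* y))) /\
  closed_form (fun x y => complex.Im (f (x +i* y)))
              (fun x y => complex.Re (f (x +i* y))).
Proof.
move=> ef.
have key x y : exists p q : R, forall e : R, 0 < e -> exists2 d : R, 0 < d &
   forall h k : R, `|h| < d -> `|k| < d ->
    `|complex.Re (f ((x + h) +i* (y + k))) - complex.Re (f (x +i* y))
        - p * h + q * k| <= e * (`|h| + `|k|) /\
    `|complex.Im (f ((x + h) +i* (y + k))) - complex.Im (f (x +i* y))
        - q * h - p * k| <= e * (`|h| + `|k|).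
  have /derivable_has_cderiv[[p q] Dpq] := ef (x +i* y).
  exists p, q => e e0; have [d d0 dP] := Dpq e e0.
  exists (d / 2); first by rewrite divr_gt0.
  move=> h k hd kd; have hk : normc (h +i* k) <= `|h| + `|k|.
    exact: normc_le_ReIm.
  have := dP (h +i* k) (le_lt_trans hk _).
  have hkd : `|h| + `|k| < d by lra.
  move=> /(_ hkd); rewrite (_ : x +i* y + h +i* k = (x + h) +i* (y + k))//.
  set w := _ - _ => hw.
  have {}hw : normc w <= e * (`|h| + `|k|) by rewrite (le_trans hw)// ler_wpM2l// ltW.
  split; apply: le_trans hw.
    rewrite (le_trans _ (normc_Re _))// le_eqVlt; apply/orP; left; apply/eqP.
    congr `| _ |; rewrite /w; case: (f _) (f _) => [? ?] [? ?] /=; ring.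
  rewrite (le_trans _ (normc_Im _))// le_eqVlt; apply/orP; left; apply/eqP.
  congr `| _ |; rewrite /w; case: (f _) (f _) => [? ?] [? ?] /=; ring.
split=> x y; have [p [q H]] := key x y.
- exists p, (- q), (- p) => e /H[d d0 dP]; exists d => // h k hd kd.
  have [e1 e2] := dP h k hd kd; split.
    by move: e1; congr (`| _ | <= _); ring.
  by rewrite -normrN; move: e2; congr (`| _ | <= _); ring.
- exists q, p, (- q) => e /H[d d0 dP]; exists d => // h k hd kd.
  have [e1 e2] := dP h k hd kd; split=> //.
  by move: e1; congr (`| _ | <= _); ring.
Qed.

(** The two vertical edges of the Goursat rectangle cancel by periodicity. *)
Lemma entire_periodic_mean f : entire f -> (forall z, f (z + 1) = f z) ->
  forall y1 y2, mean01 (fun x => f (x +i* y1)) =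
                mean01 (fun x => f (x +i* y2)).
Proof.
move=> ef fper.
have f01 y : f ((0 + 1) +i* y) = f (0 +i* y).
  by rewrite -[in RHS]fper; congr f; simpc.
have [c1 c2] := entire_closed_form ef.
wlog y12 : / forall y1 y2, y1 <= y2 ->
    mean01 (fun x => f (x +i* y1)) =
    mean01 (fun x => f (x +i* y2)).
  move=> H y1 y2; suff h : forall y1 y2, y1 <= y2 ->
    mean01 (fun x => f (x +i* y1)) =
    mean01 (fun x => f (x +i* y2)).
    by have [|/ltW] := leP y1 y2 => /h.
  move=> {H}{}y1 {}y2 y12.
  have h0 : 0 <= y2 - y1 by rewrite subr_ge0.
  have cRe y := (entire_line_x y ef).1; have cIm y := (entire_line_x y ef).2.
  have dRe x := (entire_line_y x ef).1; have dIm x := (entire_line_y x ef).2.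
  have dIm' x : continuous (fun y => - complex.Im (f (x +i* y))).
    by move=> y; apply: cvgN; exact: dIm.
  have rE (P Q : R -> R -> R) : (forall y, Q (0 + 1) y = Q 0 y) ->
      rectint P Q 0 y1 1 (y2 - y1) = segint (P^~ y1) 0 1 - segint (P^~ y2) 0 1.
    move=> hQ; rewrite /rectint (_ : Q (0 + 1) = Q 0); last exact/funext.
    by rewrite addrK add0r [y1 + _]addrC subrK.
  have hIm y : - complex.Im (f ((0 + 1) +i* y)) = - complex.Im (f (0 +i* y)).
    by rewrite f01.
  have hRe y : complex.Re (f ((0 + 1) +i* y)) = complex.Re (f (0 +i* y)).
    by rewrite f01.
  have /eqP := etrans (esym (rE (fun x y => complex.Re (f (x +i* y)))
    (fun x y => - complex.Im (f (x +i* y))) hIm))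
    (@Goursat_rectangle _ _ _ cRe dIm' 0 y1 _ _ c1 ler01 h0).
  have /eqP := etrans (esym (rE (fun x y => complex.Im (f (x +i* y)))
    (fun x y => complex.Re (f (x +i* y))) hRe))
    (@Goursat_rectangle _ _ _ cIm dRe 0 y1 _ _ c2 ler01 h0).
  by rewrite !subr_eq0 => /eqP e2 /eqP e1; congr (_ +i* _).
by move=> y1 y2; have [|/ltW] := leP y1 y2 => /y12.
Qed.

(** A function of two variables that is separately continuous is a pointwise
limit of functions constant in the first variable along small segments. *)
Lemma measurable_fun_separately_continuous (g : R -> R -> R) :
  (forall y, continuous (g^~ y)) -> (forall x, continuous (g x)) ->
  measurable_fun setT
    (fun p : measurableTypeR R * measurableTypeR R => g p.1 p.2).
Proof.
move=> c1 c2.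
pose G (n : nat) (p : measurableTypeR R * measurableTypeR R) : R :=
  g ((Num.floor (n.+1%:R * (p.1 : R)))%:~R / n.+1%:R) p.2.
apply: (@measurable_fun_cvg _ _ _ _ G).
  move=> n _ Y mY.
  have n0 : (0 : R) < n.+1%:R by [].
  rewrite setTI (_ : _ @^-1` _ = \bigcup_(k : int)
      (`[(k%:~R / n.+1%:R : R), (k + 1)%:~R / n.+1%:R[%classic `*`
       (g (k%:~R / n.+1%:R) @^-1` Y))).
    apply: countable_bigcupT_measurable => // k; apply: measurableX.
      exact: measurable_itv.
    by rewrite -[_ @^-1` _]setTI; exact: continuous_measurable_fun.
  apply/seteqP; split => -[x y] /=; rewrite /G /=.
    move=> Yg; exists (Num.floor (n.+1%:R * x)) => //=; split=> //.
    rewrite in_itv /= ler_pdivrMr// ltr_pdivlMr// ![x * _]mulrC.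
    by rewrite floor_le floorD1_gt.
  move=> [k _ []] /=.
  rewrite in_itv /= ler_pdivrMr// ltr_pdivlMr// ![x * _]mulrC => kx.
  by have -> : Num.floor (n.+1%:R * x) = k by exact: floor_def.
move=> [x y] _ /=; rewrite /G /=.
have : (fun n : nat => (Num.floor (n.+1%:R * x))%:~R / n.+1%:R) @ \oo --> x.
  apply/cvgrPdist_le => e e0.
  near=> n.
  have n0 : (0 : R) < n.+1%:R by [].
  rewrite -[x in `|x - _|](mulKf (lt0r_neq0 n0)) [_^-1 * _]mulrC -mulrBl normrM.
  rewrite [`|_^-1|]gtr0_norm ?invr_gt0// ler_pdivrMr//.
  have h1 := floor_le (n.+1%:R * x); have h2 := floorD1_gt (n.+1%:R * x).
  rewrite intrD in h2; rewrite ger0_norm ?subr_ge0//.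
  rewrite (le_trans (y := 1))//; first by lra.
  rewrite -ler_pdivrMr// div1r.
  by apply/ltW; near: n; exact: (near_infty_natSinv_lt (PosNum e0)).
move=> h; exact: (cvg_comp _ _ h (c1 y x)).
Unshelve. all: by end_near. Qed.

Lemma entire_measurable f : entire f ->
  cmeasurable setT (fun p : measurableTypeR R * measurableTypeR R => f (p.1 +i* p.2)).
Proof.
move=> ef; split.
  apply: (@measurable_fun_separately_continuous (fun x y => complex.Re (f (x +i* y)))).
    by move=> y; exact: (entire_line_x y ef).1.
  by move=> x; exact: (entire_line_y x ef).1.
apply: (@measurable_fun_separately_continuous (fun x y => complex.Im (f (x +i* y)))).
  by move=> y; exact: (entire_line_x y ef).2.
by move=> x; exact: (entire_line_y x ef).2.
Qed.

End EntireFunctions.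

(** * Pointwise convergence of Fourier series *)

Section Quotients.
Context {R : realType}.
Implicit Types (a b A B : R[i]) (f g : R[i] -> R[i]).

Lemma div_near A B (e : R) : B != 0 -> 0 < e -> exists2 d : R, 0 < d &
  forall a b, normc (a - A) <= d -> normc (b - B) <= d ->
    b != 0 /\ normc (a / b - A / B) <= e.
Proof.
rewrite -normc_gt0 => B0 e0; have A0 := normc_ge0 A.
(* A Lipschitz constant of the quotient while [b] stays within [normc B / 2] of [B]. *)
set M := 2 * (normc A + normc B) / normc B ^+ 2.
have M0 : 0 < M by rewrite divr_gt0 ?exprn_gt0// mulr_gt0// ltr_wpDl.
have B2 : 0 < normc B / 2 by rewrite divr_gt0.
exists (Num.min (normc B / 2) (e / M)); first by rewrite lt_min B2 (divr_gt0 e0 M0).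
move=> a b; rewrite !le_min => /andP[_ aA] /andP[bB bB'].
rewrite ler_pdivlMr// in aA; rewrite ler_pdivlMr// in bB'.
have bn : normc B / 2 <= normc b.
  have := le_normcD (B - b) b; rewrite subrK normc_distrC; lra.
have b0 : 0 < normc b by apply: lt_le_trans bn; rewrite divr_gt0.
have b0' : b != 0 by rewrite -normc_gt0.
have B0' : B != 0 by rewrite -normc_gt0.
split=> //.
have -> : a / b - A / B = ((a - A) * B - A * (b - B)) / (b * B).
  by field; rewrite b0' B0'.
rewrite normcM normcV normcM ler_pdivrMr ?mulr_gt0//.
rewrite (le_trans (ler_normcB _ _))// !normcM.
have eB : e * (normc B / 2 * normc B) <= e * (normc b * normc B).
  by rewrite ler_wpM2l ?(ltW e0)// ler_pM2r.
apply: le_trans eB; rewrite /M in aA bB'.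
have h1 : normc (a - A) * normc B * (2 * (normc A + normc B)) <= e * normc B ^+ 3.
  move: aA; rewrite mulrA ler_pdivrMr ?exprn_gt0// => aA.
  by have := ler_wpM2r (ltW B0) aA; rewrite exprS; lra.
have h2 : normc A * normc (b - B) * (2 * (normc A + normc B)) <=
    e * normc A * normc B ^+ 2.
  move: bB'; rewrite mulrA ler_pdivrMr ?exprn_gt0// => bB'.
  by have := ler_wpM2r A0 bB'; lra.
have S0 : 0 < 2 * (normc A + normc B) by rewrite mulr_gt0// ltr_wpDl.
rewrite -(ler_pM2r S0) mulrDl (le_trans (lerD h1 h2))//.
by rewrite le_eqVlt; apply/orP; left; apply/eqP; field.
Qed.

(** At a common zero, dividing both functions by the increment shows that the
quotient tends to that of the derivatives. *)
Lemma quotient_on_line f g (y : R) : entire f -> entire g ->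
  (forall x, g (x +i* y) = 0 -> f (x +i* y) = 0 /\
     exists2 D, D != 0 & has_cderiv g (x +i* y) D) ->
  exists H, ccontinuous H /\ forall x, f (x +i* y) = H x * g (x +i* y).
Proof.
move=> ef eg fg.
have Vex x : exists v, g (x +i* y) = 0 -> exists A B,
    [/\ B != 0, has_cderiv f (x +i* y) A, has_cderiv g (x +i* y) B & v = A / B].
  have [/fg[_ [B B0 gB]]|g0] := eqVneq (g (x +i* y)) 0; last first.
    by exists 0 => /eqP; rewrite (negPf g0).
  have /derivable_has_cderiv[A fA] := ef (x +i* y).
  by exists (A / B) => _; exists A, B.
have [V VP] := choice Vex.
exists (fun x => if g (x +i* y) == 0 then V x else f (x +i* y) / g (x +i* y)).
split; last first.
  move=> x; case: eqVneq => [g0|g0]; last by rewrite divfK.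
  by rewrite g0 mulr0; exact: (fg x g0).1.
apply: ccontinuous_near => x e e0.
have shift (h : R) : (x + h) +i* y = x +i* y + h%:C by simpc.
have [g0|g0] := eqVneq (g (x +i* y)) 0; last first.
  have [d d0 dP] := div_near (f (x +i* y)) g0 e0.
  have [d1 d10 P1] := entire_near ef (x +i* y) d0.
  have [d2 d20 P2] := entire_near eg (x +i* y) d0.
  exists (Num.min d1 d2); first by rewrite lt_min d10.
  move=> h; rewrite lt_min => /andP[h1 h2]; rewrite shift.
  have := P1 h%:C; rewrite normc_real => /(_ h1) k1.
  have := P2 h%:C; rewrite normc_real => /(_ h2) k2.
  by have [n0 n1] := dP _ _ k1 k2; rewrite (negPf n0).
have [A [B [B0 fA gB VE]]] := VP x g0; have f0 := (fg x g0).1.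
have [d d0 dP] := div_near A B0 e0.
have [d1 d10 P1] := fA d d0; have [d2 d20 P2] := gB d d0.
exists (Num.min d1 d2); first by rewrite lt_min d10.
move=> h; have [->|h0] := eqVneq h 0.
  by rewrite addr0 g0 eqxx subrr normc0 (ltW e0).
rewrite lt_min => /andP[h1 h2]; rewrite shift.
have hn : 0 < normc h%:C by rewrite normc_real normr_gt0.
have hc : h%:C != 0 by rewrite -normc_gt0.
have quo u D : normc (u - 0 - D * h%:C) <= d * normc h%:C ->
    normc (u / h%:C - D) <= d.
  by rewrite subr0 => H; rewrite -(ler_pM2r hn) -normcM mulrBl divfK.
have := P1 h%:C; rewrite normc_real => /(_ h1); rewrite f0 -normc_real => /quo k1.
have := P2 h%:C; rewrite normc_real => /(_ h2); rewrite g0 -normc_real => /quo k2.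
have [n0 n1] := dP _ _ k1 k2.
have gn : g (x +i* y + h%:C) != 0.
  by apply: contraNneq n0 => ->; rewrite mul0r.
rewrite (negPf gn) VE.
suff -> : f (x +i* y + h%:C) / g (x +i* y + h%:C) =
   f (x +i* y + h%:C) / h%:C / (g (x +i* y + h%:C) / h%:C) by [].
by field; rewrite hc gn.
Qed.

End Quotients.

Section FourierSeries.
Context {R : realType}.
Implicit Types (m n : int) (x y t : R).

Definition fchar n x : R[i] := cexp (2 * 'i%C * pi%:C * n%:~R * x%:C).

Lemma fcharD n x y : fchar n (x + y) = fchar n x * fchar n y.
Proof. by rewrite /fchar realcD mulrDr cexpD. Qed.

Lemma fcharDn m n x : fchar (m + n) x = fchar m x * fchar n x.
Proof. by rewrite /fchar intrD mulrDr mulrDl cexpD. Qed.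

Lemma fchar0 x : fchar 0 x = 1.
Proof. by rewrite /fchar mulr0 mul0r cexp0. Qed.

Lemma fcharE n x : fchar n x = cexp (0 +i* (2 * pi * n%:~R * x)).
Proof.
rewrite /fchar; congr cexp; rewrite -[n%:~R](rmorph_int (real_complex R)).
by rewrite -(realc_nat 2); simpc.
Qed.

Lemma normc_fchar n x : normc (fchar n x) = 1.
Proof. by rewrite fcharE normc_cexp /= expR0. Qed.

Lemma fcharNx n x : fchar n (- x) = ((fchar n x)^*)%C.
Proof. by rewrite !fcharE conj_cexp mulrN. Qed.

Lemma fcharN n x : fchar (- n) x = ((fchar n x)^*)%C.
Proof. by rewrite -fcharNx /fchar mulrNz realcN !mulrN mulNr. Qed.

Lemma ccontinuous_fchar n : ccontinuous (fchar n).
Proof.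
have := entire_line_x 0 (@entire_cexp_quad R 0 (2 * 'i%C * pi%:C * n%:~R) 0).
congr ccontinuous; apply/funext => x; rewrite mul0r add0r addr0 /fchar.
by congr cexp.
Qed.

(** Moving from height 0 to height 1 leaves the mean of [exp (2 i pi n z)] over a
horizontal period unchanged and also multiplies it by [exp (- 2 pi n)]. *)
Lemma mean_fchar n : mean01 (fchar n) = (n == 0)%:R.
Proof.
have [->|n0] := eqVneq n 0.
  rewrite (_ : fchar 0 = fun=> 1); last by apply/funext => x; rewrite fchar0.
  rewrite /mean01 /cintegral /= !Rintegral_cst//= lebesgue_measure_itv /= lte01 oppr0 addr0.
  by rewrite mul0r mulr1.
pose b : R[i] := 2 * 'i%C * pi%:C * n%:~R.
have eb := @entire_cexp_quad R 0 b 0.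
have bper z : cexp (0 * (z + 1) ^+ 2 + b * (z + 1) + 0) = cexp (0 * z ^+ 2 + b * z + 0).
  by rewrite !mul0r !add0r !addr0 mulrDr cexpD mulr1 cexp_2ipi_int mulr1.
have := entire_periodic_mean eb bper 1 0.
have bE x y : cexp (0 * (x +i* y) ^+ 2 + b * (x +i* y) + 0) =
    cexp (b * (0 +i* y)) * fchar n x.
  by rewrite mul0r add0r addr0 /fchar -cexpD -mulrDr; congr (cexp (_ * _)); simpc.
under eq_fun do rewrite bE; under [X in _ = mean01 X]eq_fun do rewrite bE.
have b0 : cexp (b * (0 +i* 0)) = 1 by rewrite (_ : b * (0 +i* 0) = 0) ?cexp0// mulr0.
rewrite b0 !(mean01Z _ (ccontinuous_fchar n)).
move=> /eqP; rewrite -subr_eq0 -mulrBl mulf_eq0 subr_eq0.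
case/orP => [/eqP h|/eqP//]; exfalso; move/(congr1 (@normc R)): h.
rewrite normc1 normc_cexp /b.
have -> : 2 * 'i%C * pi%:C * n%:~R * (0 +i* 1) = (- (2 * pi * n%:~R))%:C :> R[i].
  rewrite -[n%:~R](rmorph_int (real_complex R)) -(realc_nat 2); simpc.
  by congr (_ +i* _); ring.
rewrite /= => /eqP; rewrite -[X in _ == X]expR0 => /eqP/expR_inj/eqP.
by rewrite oppr_eq0 !mulf_eq0 pnatr_eq0 intr_eq0 (negPf n0) orbF (gt_eqF (pi_gt0 R)).
Qed.

Lemma fchar_orthonormal m n : dot01 (fchar m) (fchar n) = (m == n)%:R.
Proof.
transitivity (mean01 (fchar (m - n))); last by rewrite mean_fchar subr_eq0.
by congr mean01; apply/funext => x; rewrite fcharDn fcharN.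
Qed.

Lemma ccontinuous_fchar_shift n x0 : ccontinuous (fun x => fchar n (x0 - x)).
Proof.
have := ccontinuousM (ccontinuous_conj (ccontinuous_fchar n))
  (_ : ccontinuous (fun=> fchar n x0)).
have -> : (fun t => ((fchar n t)^*)%C * fchar n x0) = (fun x => fchar n (x0 - x)).
  by apply/funext => x; rewrite fcharD fcharNx mulrC.
by apply; split=> t; exact: cvg_cst.
Qed.

Lemma bounded_sum_cvg0 (u : nat -> R) (B : R) : (forall k, 0 <= u k) ->
  (forall N, \sum_(0 <= k < N) u k <= B) -> u @ \oo --> (0 : R).
Proof.
move=> u0 uB; apply: cvg_series_cvg_0; apply: nondecreasing_is_cvgn.
  by apply/nondecreasing_seqP => k; rewrite /series/= big_nat_recr//= lerDl.
by exists B => _ [N _ <-]; exact: uB.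
Qed.

(** The Riemann-Lebesgue lemma: by Bessel the coefficients are square-summable. *)
Lemma fourier_coef_cvg0 (H : R -> R[i]) : ccontinuous H ->
  (fun k : nat => normc (dot01 H (fchar (Posz k)))) @ \oo --> (0 : R) /\
  (fun k : nat => normc (dot01 H (fchar (Negz k)))) @ \oo --> (0 : R).
Proof.
move=> cH; set B := dot_norm dot01 H ^+ 2.
have bes N := sip_Bessel semi_inner_product01 ccontinuous_fchar
  fchar_orthonormal (zwindow_uniq N) cH.
have sq (v : nat -> R[i]) : (forall N, \sum_(0 <= k < N) normc (v k) ^+ 2 <= B) ->
    (fun k => normc (v k)) @ \oo --> (0 : R).
  move=> vB; have h : (fun k => normc (v k) ^+ 2) @ \oo --> (0 : R).
    by apply: bounded_sum_cvg0 vB => k; exact: sqr_ge0.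
  apply/cvgrPdist_le => e e0; move/cvgrPdist_le: h => /(_ (e ^+ 2)).
  rewrite exprn_gt0// => /(_ isT); apply: filterS => k.
  rewrite !sub0r !normrN !ger0_norm ?sqr_ge0 ?normc_ge0//.
  by rewrite ler_pXn2r// nnegrE ?normc_ge0// ltW.
have s0 (v : nat -> R[i]) N : 0 <= \sum_(0 <= k < N) normc (v k) ^+ 2.
  by apply: sumr_ge0 => k _; exact: sqr_ge0.
split; apply: sq => N; rewrite (le_trans _ (bes N))// big_zwindow.
  by rewrite lerDl s0.
by rewrite lerDr s0.
Qed.

(** With [s] the fractional part of [t], [cos (2 pi s) = 1] forces
[sin (pi s) = 0], while [sin] is positive inside [[0, pi]]. *)
Lemma fchar1_eq1 t : fchar 1 t = 1 -> exists m, t = m%:~R.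
Proof.
set m := Num.floor t; set s := t - m%:~R.
have tE : t = m%:~R + s by rewrite /s addrC subrK.
have s01 : 0 <= s < 1.
  have := floor_le t; have := floorD1_gt t; rewrite intrD -/m /s; lra.
have fm : fchar 1 m%:~R = 1.
  rewrite /fchar mulr1 -[(m%:~R)%:C](_ : m%:~R = _); first exact: cexp_2ipi_int.
  by rewrite rmorph_int.
rewrite tE fcharD fm mul1r fcharE mulr1 => /(congr1 (@complex.Re R)).
rewrite cexpE /= expR0 mul1r mul0r subr0 => cs1.
exists m; rewrite -[RHS]addr0; congr (_ + _); apply/eqP.
rewrite eq_le; case/andP: s01 => -> s1; rewrite andbT leNgt; apply/negP => s0.
have := @sin_gt0_pi R (pi * s); rewrite mulr_gt0 ?pi_gt0//=.
rewrite -{2}[pi]mulr1 ltr_pM2l ?pi_gt0// s1 => /(_ isT).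
suff : sin (pi * s) ^+ 2 = 0 by move/eqP; rewrite sqrf_eq0 => /eqP->; rewrite ltxx.
have := cos_mulr2n (pi * s); rewrite cos2sin2.
have -> : (pi * s) *+ 2 = 2 * pi * s by rewrite -mulr_natl mulrA.
rewrite cs1; lra.
Qed.

Lemma periodic_int (f : R[i] -> R[i]) : (forall z, f (z + 1) = f z) ->
  forall z m, f (z + m%:~R) = f z.
Proof.
move=> fper.
have h z (k : nat) : f (z + k%:R) = f z.
  elim: k => [|k IH]; first by rewrite addr0.
  by rewrite -(natr1 k) addrA fper.
move=> z [k|k]; first exact: h.
by rewrite NegzE mulrNz -[LHS](h _ k.+1) subrK.
Qed.

(** Chernoff's argument: writing [f (x) = f (x0) + H (x) (e (x - x0) - 1)] on the
line, with [e = fchar 1] and [H] continuous, makes the [n]th term the difference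
of two consecutive Fourier terms of [H], apart from [f (x0)] at [n = 0]. The sum
telescopes, and what is left tends to 0. *)
Lemma fourier_expansion (f : R[i] -> R[i]) (x0 y : R) : entire f ->
  (forall z, f (z + 1) = f z) ->
  clim (fun N => \sum_(n <- zwindow N)
          mean01 (fun x => f (x +i* y) * fchar n (x0 - x))) (f (x0 +i* y)).
Proof.
move=> ef fper; set f0 := f _.
set b : R[i] := 2 * 'i%C * pi%:C.
have bE (x : R) : cexp (0 * (x +i* y) ^+ 2 + b * (x +i* y) + - (b * (x0 +i* y))) =
   fchar 1 (x - x0).
  rewrite mul0r add0r -mulrBr /fchar mulr1; congr (cexp (_ * _)).
  by apply/eqP; rewrite eq_complex /= subrr !eqxx.
have eg : entire (fun z => cexp (0 * z ^+ 2 + b * z + - (b * (x0 +i* y))) - 1).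
  apply: entireB; last exact: entire_cst.
  exact: (@entire_cexp_quad R 0 b (- (b * (x0 +i* y)))).
have efc : entire (fun z => f z - f0) 
  by exact: (@entireB R f (fun=> f0) ef (@entire_cst R f0)).
have [x|H [cH HP]] := quotient_on_line (y := y) efc eg.
  rewrite bE => /eqP; rewrite subr_eq0 => /eqP e1; split.
    have [m xm] := fchar1_eq1 e1.
    rewrite /f0; have -> : x +i* y = x0 +i* y + m%:~R.
      rewrite -[m%:~R](rmorph_int (real_complex R)) -xm; simpc.
      by rewrite addrC subrK.
    by rewrite periodic_int// subrr.
  exists b.
    rewrite /b !mulf_neq0 ?pnatr_eq0//.
      by apply/eqP => -[] /eqP; rewrite oner_eq0.
    by rewrite -normc_gt0 normc_real normr_gt0 gt_eqF// pi_gt0.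
  apply: (@has_cderiv_quad _ (4 * expR (normc b) * normc b ^+ 2)) => h h1.
  rewrite bE e1 subrr subr0.
  have -> : 0 * (x +i* y + h) ^+ 2 + b * (x +i* y + h) + - (b * (x0 +i* y)) =
     (0 * (x +i* y) ^+ 2 + b * (x +i* y) + - (b * (x0 +i* y))) + b * h by ring.
  rewrite cexpD bE e1 mul1r (le_trans (cexp_sub1_sub_le _))// normcM exprMn mulrA.
  rewrite ler_wpM2r ?sqr_ge0// ler_wpM2r ?sqr_ge0// ler_wpM2l// ler_expR.
  by rewrite ler_piMr ?normc_ge0.
pose D n := mean01 (fun x => H x * fchar n (x0 - x)).
have cfx n : ccontinuous (fun x => fchar n (x0 - x)).
  exact: ccontinuous_fchar_shift.
have DE n : D n = fchar n x0 * dot01 H (fchar n).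
  rewrite /dot01 -mean01Z; last first.
    by apply: ccontinuousM => //; exact/ccontinuous_conj/ccontinuous_fchar.
  by congr mean01; apply/funext => x; rewrite fcharD fcharNx mulrCA.
have nD n : normc (D n) = normc (dot01 H (fchar n)).
  by rewrite DE normcM normc_fchar mul1r.
have cHfx n : ccontinuous (fun x => H x * fchar n (x0 - x)) by exact: ccontinuousM.
have mfx n : mean01 (fun x => fchar n (x0 - x)) = (n == 0)%:R.
  have -> : (fun x => fchar n (x0 - x)) = (fun x => fchar n x0 * fchar (- n) x).
    by apply/funext => x; rewrite fcharD fcharNx fcharN.
  rewrite mean01Z; last exact: ccontinuous_fchar.
  rewrite mean_fchar oppr_eq0; case: eqVneq => [->|_]; rewrite ?mulr0//.
  by rewrite fchar0 mulr1.
have term n : mean01 (fun x => f (x +i* y) * fchar n (x0 - x)) =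
    f0 * (n == 0)%:R + (D (n - 1) - D n).
  have -> : (fun x => f (x +i* y) * fchar n (x0 - x)) =
     fun x => - 1 * (H x * fchar n (x0 - x)) + (f0 * fchar n (x0 - x) +
              H x * fchar (n - 1) (x0 - x)).
    apply/funext => x; rewrite fcharDn fcharN -fcharNx opprB.
    have -> : f (x +i* y) = f0 + H x * (fchar 1 (x - x0) - 1).
      by rewrite -bE -HP addrC subrK.
    by ring.
  rewrite mean01ZD//; last exact: ccontinuousZD.
  by rewrite mean01ZD// mfx -/(D n) -/(D (n - 1)); ring.
have [] := fourier_coef_cvg0 cH.
under eq_fun do rewrite -nD; move=> Hp; under eq_fun do rewrite -nD; move=> Hn.
clear DE nD; clearbody D; under eq_fun do (under eq_bigr do rewrite term).
have pos N : \sum_(0 <= k < N.+1) (f0 * (Posz k == 0)%:R + (D (Posz k - 1) - D (Posz k)))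
    = f0 + D (Negz 0) - D (Posz N).
  elim: N => [|N IH]; first by rewrite big_nat1 eqxx mulr1 addrA.
  rewrite big_nat_recr//= IH mulr0 add0r.
  have -> : Posz N.+1 - 1 = Posz N by rewrite -addn1 PoszD addrK.
  by ring.
have neg N : \sum_(0 <= k < N) (f0 * (Negz k == 0)%:R + (D (Negz k - 1) - D (Negz k)))
    = D (Negz N) - D (Negz 0).
  elim: N => [|N IH]; first by rewrite big_nil subrr.
  rewrite big_nat_recr//= IH mulr0 add0r.
  have -> : Negz N - 1 = Negz N.+1 by rewrite !NegzE; lia.
  by ring.
apply: clim_shift; apply: (clim_squeeze (e := fun k =>
   normc (D (Negz k.+1)) + normc (D (Posz k)))).
  move=> N; rewrite big_zwindow pos neg.
  have -> : f0 + D (Negz 0) - D (Posz N) + (D (Negz N.+1) - D (Negz 0)) - f0 =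
    D (Negz N.+1) - D (Posz N) by ring.
  exact: ler_normcB.
rewrite -[0]addr0; apply: cvgD => //.
by rewrite (cvg_shiftS (fun k => normc (D (Negz k)))).
Qed.

End FourierSeries.

(** * The theta space as a space of square-integrable functions *)

Section FockSpace.
Context {R : realType}.
Variables (nu alpha : R).
Local Notation psi := (fock_basis nu alpha).
Local Notation mu := (@lebesgue_measure R).
Local Notation plane := (measurableTypeR R * measurableTypeR R)%type.
Implicit Types (f g : R[i] -> R[i]) (z w : R[i]) (n m : int) (p : plane).

Lemma measurable_strip : measurable (@strip R).
Proof. by apply: measurableX => //; exact: measurable_itv. Qed.

(** Splitting the weight evenly between the two functions turns [fock_dot] into
the plain [L^2] form of the strip. *)
Definition weighted f p : R[i] :=
  f (p.1 +i* p.2) * (expR (- nu / 2 * (p.1 ^+ 2 + p.2 ^+ 2)))%:C.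

Lemma gauss_weight_sqr p : gauss_weight nu (p.1 +i* p.2) =
  expR (- nu / 2 * (p.1 ^+ 2 + p.2 ^+ 2)) ^+ 2.
Proof.
rewrite /gauss_weight normc_sqr /= [RHS]expr2 -expRD; congr expR; by field.
Qed.

Lemma normc_weighted f p : normc (weighted f p) ^+ 2 =
  normc (f (p.1 +i* p.2)) ^+ 2 * gauss_weight nu (p.1 +i* p.2).
Proof.
by rewrite gauss_weight_sqr normcM normc_real ger0_norm ?expR_ge0// exprMn.
Qed.

Lemma fock_integrandE f g p :
  fock_integrand nu f g (p.1 +i* p.2) = weighted f p * ((weighted g p)^*)%C.
Proof.
rewrite /fock_integrand gauss_weight_sqr /weighted conjcM conjc_realC realcX.
by ring.
Qed.

Lemma weightedZD a f g p :
  weighted (a *: f + g) p = a * weighted f p + weighted g p.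
Proof. by rewrite /weighted mulrA -mulrDl. Qed.

Lemma weighted_measurable f : entire f -> cmeasurable strip (weighted f).
Proof.
move=> ef; suff [h1 h2] : cmeasurable setT (weighted f).
  by split; [apply: measurable_funS h1|apply: measurable_funS h2].
apply: cmeasurableM; first exact: entire_measurable.
split; last exact: measurable_cst.
apply: (@measurable_fun_separately_continuous _
  (fun x y => expR (- nu / 2 * (x ^+ 2 + y ^+ 2)))).
  move=> y x; apply: continuous_comp; last exact: continuous_expR.
  apply: cvgM; first exact: cvg_cst.
  by apply: cvgD; [exact: exprn_continuous|exact: cvg_cst].
move=> x y; apply: continuous_comp; last exact: continuous_expR.
apply: cvgM; first exact: cvg_cst.
by apply: cvgD; [exact: cvg_cst|exact: exprn_continuous].
Qed.

Lemma fock_sqnormE f :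
  fock_sqnorm nu f = (\int[lebesgue2]_(p in strip) (normc (weighted f p) ^+ 2)%:E)%E.
Proof. by apply: eq_integral => p _; rewrite normc_weighted. Qed.

Lemma fock_sqnorm_integrable f : entire f -> (fock_sqnorm nu f < +oo)%E ->
  lebesgue2.-integrable strip (fun p => (normc (weighted f p) ^+ 2)%:E).
Proof.
move=> ef nf; apply/integrableP; split.
  by apply/measurable_EFinP; apply: cmeasurable_normc; exact: weighted_measurable.
move: nf; rewrite fock_sqnormE; congr (_ < _)%E; apply: eq_integral => p _.
by rewrite /= ger0_norm ?sqr_ge0.
Qed.

Lemma fock_weighted_integrable f g : fock nu alpha f -> fock nu alpha g ->
  cintegrable lebesgue2 strip (fun p => weighted f p * ((weighted g p)^*)%C).
Proof.
move=> [ef _ nf] [eg _ ng].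
have i1 := fock_sqnorm_integrable ef nf; have i2 := fock_sqnorm_integrable eg ng.
apply: (cintegrable_dom measurable_strip
  (g := fun p => normc (weighted f p) ^+ 2 + normc (weighted g p) ^+ 2)).
- apply: cmeasurableM; first exact: weighted_measurable.
  by apply: cmeasurable_conj; exact: weighted_measurable.
- move=> p _; rewrite normcM normc_conj.
  by have := sqr_ge0 (normc (weighted f p) - normc (weighted g p));
     have := normc_ge0 (weighted f p); have := normc_ge0 (weighted g p); nra.
- exact: (integrableD measurable_strip i1 i2).
Qed.

Lemma fock_dotE f g :
  fock_dot nu f g =
  cintegral lebesgue2 strip (fun p => weighted f p * ((weighted g p)^*)%C).
Proof.
rewrite /fock_dot /strip_integral.
by congr (_ +i* _); apply: eq_Rintegral => p _; rewrite fock_integrandE.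
Qed.

Lemma fock_strip_integrable f g : fock nu alpha f -> fock nu alpha g ->
  strip_integrable (fock_integrand nu f g).
Proof.
move=> Hf Hg; have [h1 h2] := fock_weighted_integrable Hf Hg.
split; [apply: eq_integrable h1|apply: eq_integrable h2];
  by [exact: measurable_strip|move=> p _; rewrite /= fock_integrandE].
Qed.

Lemma fock_sqnormZD_lty a f g : entire f -> entire g ->
  (fock_sqnorm nu f < +oo)%E -> (fock_sqnorm nu g < +oo)%E ->
  (fock_sqnorm nu (a *: f + g)%R < +oo)%E.
Proof.
move=> ef eg nf ng.
have i1 := fock_sqnorm_integrable ef nf; have i2 := fock_sqnorm_integrable eg ng.
have i3 : lebesgue2.-integrable strip (fun p =>
    ((2 * normc a ^+ 2)%:E * (normc (weighted f p) ^+ 2)%:E +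
     2%:E * (normc (weighted g p) ^+ 2)%:E)%E).
  apply: (integrableD measurable_strip).
    exact: (integrableZl measurable_strip).
  exact: (integrableZl measurable_strip).
have /integrableP[_ i3lt] := i3.
have eag : entire (a *: f + g).
  exact: (@entireD R (fun z => a * f z) g
    (@entireM R (fun=> a) f (@entire_cst R a) ef) eg).
apply: le_lt_trans i3lt; rewrite fock_sqnormE; apply: ge0_le_integral => //.
- exact: measurable_strip.
- by move=> p _; rewrite lee_fin sqr_ge0.
- by apply/measurable_EFinP; apply: cmeasurable_normc; exact: weighted_measurable.
- by apply: measurableT_comp => //; have /integrableP[] := i3.
move=> p _; rewrite -!EFinM -EFinD /= lee_fin weightedZD.
rewrite (le_trans _ (ler_norm _))//.
have := le_normcD (a * weighted f p) (weighted g p); rewrite normcM.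
have := normc_ge0 (weighted f p); have := normc_ge0 (weighted g p).
have := normc_ge0 (a * weighted f p + weighted g p); have := normc_ge0 a.
set s := normc (_ + _); set u := normc (weighted f p); set v := normc (weighted g p).
move=> a0 s0 v0 u0 h; have := sqr_ge0 (normc a * u - v).
have : s ^+ 2 <= (normc a * u + v) ^+ 2.
  by rewrite ler_pXn2r// nnegrE// addr_ge0// mulr_ge0.
rewrite sqrrD sqrrB exprMn; lra.
Qed.

Lemma fock_linear_subspace : linear_subspace (fock nu alpha).
Proof.
split.
  split.
  - exact: (@entire_cst R 0).
  - by move=> z m; rewrite /= mulr0.
  - rewrite fock_sqnormE (eq_integral (fun=> 0%E)) ?integral0 ?ltry// => p _.
    by rewrite /weighted mul0r normc0 expr0n.
move=> a f g [ef qf nf] [eg qg ng]; split.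
- exact: (@entireD R (fun z => a * f z) g
    (@entireM R (fun=> a) f (@entire_cst R a) ef) eg).
- move=> z m; change (a * f (z + m%:~R) + g (z + m%:~R) =
    cexp (2 * 'i%C * pi%:C * alpha%:C * m%:~R) *
    cexp (nu%:C * (z + m%:~R / 2) * m%:~R) * (a * f z + g z)).
  by rewrite qf qg; ring.
- exact: fock_sqnormZD_lty.
Qed.

Lemma fock_sip : semi_inner_product (fock nu alpha) (fock_dot nu).
Proof.
have -> : fock_dot nu = fun f g =>
    cintegral lebesgue2 strip (fun p => weighted f p * ((weighted g p)^*)%C).
  by apply/funext => f; apply/funext => g; exact: fock_dotE.
apply: (cintegral_semi_inner_product measurable_strip fock_linear_subspace).
  by move=> a u v p; exact: weightedZD.
exact: fock_weighted_integrable.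
Qed.

Lemma strip_fubini (g : R -> R -> R) (k : R -> R) :
  lebesgue2.-integrable strip (fun p => (g p.1 p.2)%:E) ->
  (forall y, (\int[mu]_(x in `[0%R, 1%R]) (g x y)%:E = (k y)%:E)%E) ->
  (\int[lebesgue2]_(p in strip) (g p.1 p.2)%:E = \int[mu]_y (k y)%:E)%E.
Proof.
move=> ig gk; rewrite integral_mkcond /lebesgue2 /=.
rewrite -integral21_prod_meas1/=.
  apply: eq_integral => y _; rewrite -gk [RHS]integral_mkcond.
  apply: eq_integral => x _; rewrite /patch.
  by rewrite /strip in_setX /= in_setT andbT.
by move/(integrable_mkcond _ measurable_strip): ig.
Qed.

Lemma strip_tonelli (g : R -> R -> R) (k : R -> R) :
  measurable_fun strip (fun p : plane => g p.1 p.2) ->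
  (forall x y, 0 <= g x y) ->
  (forall y, (\int[mu]_(x in `[0%R, 1%R]) (g x y)%:E = (k y)%:E)%E) ->
  (\int[lebesgue2]_(p in strip) (g p.1 p.2)%:E = \int[mu]_y (k y)%:E)%E.
Proof.
move=> mg g0 gk; rewrite integral_mkcond /lebesgue2 /=.
rewrite fubini_tonelli2/=.
- apply: eq_integral => y _; rewrite /fubini_G -gk [RHS]integral_mkcond.
  apply: eq_integral => x _; rewrite /patch.
  by rewrite /strip in_setX /= in_setT andbT.
- apply/(measurable_restrictT _ measurable_strip).
  exact/measurable_EFinP.
- by move=> p; rewrite /patch; case: ifP; rewrite ?lee_fin.
Qed.

End FockSpace.

(** * Inner products with the theta basis *)

Section ThetaCoefficients.
Context {R : realType}.
Variables (nu alpha : R).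
Hypothesis nu_gt0 : 0 < nu.
Local Notation psi := (fock_basis nu alpha).
Local Notation mu := (@lebesgue_measure R).
Local Notation plane := (measurableTypeR R * measurableTypeR R)%type.
Implicit Types (f g : R[i] -> R[i]) (z w : R[i]) (n m : int) (p : plane).

(** The normal density that [|psi n|^2] becomes against the Gaussian weight. *)
Definition basis_pdf n : R -> R :=
  normal_pdf (- (pi * (n%:~R + alpha) / nu)) (2 * Num.sqrt nu)^-1.

Lemma basis_pdf_ge0 n y : 0 <= basis_pdf n y.
Proof. exact: normal_pdf_ge0. Qed.

Lemma integral_basis_pdf n : (\int[mu]_y (basis_pdf n y)%:E = 1)%E.
Proof. exact: integral_normal_pdf. Qed.

Lemma basis_pdfE n (x y : R) :
  normc (weighted nu (psi n) (x, y)) ^+ 2 = basis_pdf n y.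
Proof.
have sn : Num.sqrt nu ^+ 2 = nu by rewrite sqr_sqrtr// ltW.
have sn0 : 0 < Num.sqrt nu by rewrite sqrtr_gt0.
have pi0 := pi_gt0 R.
have n1 : nu != 0 by rewrite gt_eqF.
have q1 : pi != 0 :> R by rewrite gt_eqF.
rewrite normc_weighted /= normc_fock_basis /gauss_weight normc_sqr /=.
rewrite /basis_pdf normal_pdfE ?invr_neq0// ?mulf_neq0 ?gt_eqF//.
rewrite /normal_peak /normal_fun exprMn.
have -> : ((2 * Num.sqrt nu)^-1) ^+ 2 = (4 * nu)^-1.
  by rewrite exprVn exprMn sn; congr (_^-1); ring.
have -> : ((2 * nu / pi) `^ 4^-1) ^+ 2 = (Num.sqrt ((4 * nu)^-1 * pi *+ 2))^-1.
  rewrite expr2 -powRD; last first.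
    by apply/implyP => _; rewrite gt_eqF// divr_gt0// mulr_gt0.
  rewrite -sqrtrV; last by rewrite mulrn_wge0// mulr_ge0 ?invr_ge0 ?mulr_ge0// ltW.
  rewrite -powR12_sqrt; last first.
    by rewrite invr_ge0 mulrn_wge0// mulr_ge0 ?invr_ge0 ?mulr_ge0// ltW.
  congr (_ `^ _); last by field.
  by move: (pi : R) q1 => a a0; field; rewrite n1 a0.
rewrite -[LHS]mulrA; congr (_ * _); rewrite [X in X * _ = _]expr2 -!expRD; congr expR.
by move: (pi : R) => a; field; rewrite n1.
Qed.

Lemma fock_basis_in_fock n : fock nu alpha (psi n).
Proof.
split; [exact: entire_fock_basis|exact: quasi_periodic_fock_basis|].
rewrite fock_sqnormE (eq_integral (fun p : plane => (basis_pdf n p.2)%:E)); last first.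
  by move=> [x y] _; rewrite basis_pdfE.
rewrite (@strip_tonelli _ (fun x y => basis_pdf n y) (basis_pdf n)).
- by rewrite integral_basis_pdf ltry.
- apply: (measurable_funS (E := setT)) => //.
  apply: (measurableT_comp (f := basis_pdf n)); last exact: measurable_snd.
  exact: measurable_normal_pdf.
- by move=> x y; exact: basis_pdf_ge0.
- move=> y; rewrite integral_cst//= lebesgue_measure_itv /= lte01 oppr0 addr0 mule1//.
Qed.

Lemma fock_quotient_entire f n : entire f -> entire (fun z => f z / psi n z).
Proof. by move=> ef; apply: entireM ef _; exact: entire_fock_basisV. Qed.

Lemma fock_quotient_periodic f n : quasi_periodic nu alpha f ->
  forall z, f (z + 1) / psi n (z + 1) = f z / psi n z.
Proof.
move=> qf z; have := qf z 1; have := quasi_periodic_fock_basis nu alpha n z 1.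
rewrite mulr1z => -> ->; set A := cexp _ * cexp _.
have A0 : A != 0 by rewrite mulf_neq0// cexp_neq0.
by rewrite invfM mulrACA divff// mul1r.
Qed.

Lemma weighted_quotient f n (x y : R) :
  weighted nu f (x, y) * ((weighted nu (psi n) (x, y))^*)%C =
  f (x +i* y) / psi n (x +i* y) * (basis_pdf n y)%:C.
Proof.
have p0 := fock_basis_neq0 alpha nu_gt0 n (x +i* y).
rewrite -(basis_pdfE n x) -mul_conjc mulrA; congr (_ * _).
by rewrite /weighted /= mulrA divfK.
Qed.

Lemma strip_integral_product (q : R -> R -> R) (c : R) n :
  (forall y, continuous (q^~ y)) ->
  (forall y, \int[mu]_(x in `[0, 1]) q x y = c) ->
  lebesgue2.-integrable strip (fun p => (q p.1 p.2 * basis_pdf n p.2)%:E) ->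
  \int[lebesgue2]_(p in strip) (q p.1 p.2 * basis_pdf n p.2) = c.
Proof.
move=> cq qc iq; rewrite /Rintegral.
rewrite (@strip_fubini _ (fun x y => q x y * basis_pdf n y)
  (fun y => c * basis_pdf n y))//.
  under eq_integral do rewrite EFinM.
  rewrite integralZl//; last exact: integrable_normal_pdf.
  by rewrite integral_basis_pdf mule1.
move=> y; have iqy := continuous_itv_integrable 0 1 (cq y).
under eq_integral do rewrite EFinM muleC.
rewrite integralZl// [RHS]EFinM muleC; congr (_ * _)%E.
by rewrite -(qc y) /Rintegral fineK// integrable_fin_num.
Qed.

(** The inner product with [psi n] is the [n]th Fourier coefficient of [f],
read at any height: [basis_pdf n] has total mass 1. *)
Lemma fock_dot_basis f n (y : R) : fock nu alpha f ->
  fock_dot nu f (psi n) = mean01 (fun x => f (x +i* y) / psi n (x +i* y)).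
Proof.
move=> Hf; have [ef qf _] := Hf.
have eq_ := @fock_quotient_entire f n ef.
have per := entire_periodic_mean eq_ (fock_quotient_periodic n qf).
set c := mean01 _; have cE y' : mean01 (fun x => f (x +i* y') / psi n (x +i* y')) = c.
  exact: per.
have [h1 h2] := fock_weighted_integrable Hf (fock_basis_in_fock n).
rewrite fock_dotE /cintegral [RHS]complexE.
have -> : (complex.Re c)%:C + 'i%C * (complex.Im c)%:C = complex.Re c +i* complex.Im c.
  by simpc.
have reE (p : plane) : complex.Re (weighted nu f p * ((weighted nu (psi n) p)^*)%C) =
    complex.Re (f (p.1 +i* p.2) / psi n (p.1 +i* p.2)) * basis_pdf n p.2.
  by case: p => x y'; rewrite weighted_quotient; case: (_ / _) => a b /=; ring.
have imE (p : plane) : complex.Im (weighted nu f p * ((weighted nu (psi n) p)^*)%C) =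
    complex.Im (f (p.1 +i* p.2) / psi n (p.1 +i* p.2)) * basis_pdf n p.2.
  by case: p => x y'; rewrite weighted_quotient; case: (_ / _) => a b /=; ring.
congr (_ +i* _).
  rewrite (eq_Rintegral _ (fun p _ => reE p)).
  apply: (@strip_integral_product
    (fun x y => complex.Re (f (x +i* y) / psi n (x +i* y)))).
  - by move=> y'; exact: (entire_line_x y' eq_).1.
  - by move=> y'; rewrite -(cE y').
  - by move: h1; congr (_.-integrable _ _); apply/funext => p /=; rewrite reE.
rewrite (eq_Rintegral _ (fun p _ => imE p)).
apply: (@strip_integral_product
  (fun x y => complex.Im (f (x +i* y) / psi n (x +i* y)))).
- by move=> y'; exact: (entire_line_x y' eq_).2.
- by move=> y'; rewrite -(cE y').
- by move: h2; congr (_.-integrable _ _); apply/funext => p /=; rewrite imE.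
Qed.

(** The Gaussian factor in [z] is common to all [psi n], so that along a horizontal
line two of them differ by a character and a constant. *)
Lemma fock_basis_shift m n (x0 x y : R) :
  psi n (x0 +i* y) / psi n (x +i* y) =
  psi m (x0 +i* y) / psi m (x +i* y) * fchar (n - m) (x0 - x).
Proof.
have h k : psi k (x0 +i* y) / psi k (x +i* y) =
   cexp ((nu / 2)%:C * ((x0 +i* y) ^+ 2 - (x +i* y) ^+ 2) +
         (2 * pi * (k%:~R + alpha))%:C * 'i%C * (x0 - x)%:C).
  have c0 : ((2 * nu / pi) `^ 4^-1)%:C != 0 :> R[i].
    rewrite -normc_gt0 normc_real normr_gt0 gt_eqF// powR_gt0// divr_gt0 ?pi_gt0//.
    exact: mulr_gt0.
  rewrite !fock_basisE invfM mulrACA divff// mul1r -cexpN -cexpD; congr cexp.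
  have -> : (x0 - x)%:C = x0 +i* y - (x +i* y).
    by apply/eqP; rewrite eq_complex /= subrr !eqxx.
  by ring.
rewrite !h /fchar -cexpD; congr cexp; rewrite -addrA; congr (_ + _).
rewrite -[(n - m)%:~R](rmorph_int (real_complex R)) intrB -(realc_nat 2) /=.
by rewrite !(realcM, realcD, realcN); ring.
Qed.

Lemma fock_basis_orthonormal m n : fock_dot nu (psi m) (psi n) = (m == n)%:R.
Proof.
rewrite (fock_dot_basis n 0 (fock_basis_in_fock m)).
have -> : (fun x => psi m (x +i* 0) / psi n (x +i* 0)) =
    fun x => psi m (0 +i* 0) / psi n (0 +i* 0) * fchar (m - n) x.
  apply/funext => x; have := fock_basis_shift n m x 0 0; rewrite subr0.
  have [p0 q0] := (fock_basis_neq0 alpha nu_gt0 m (0 +i* 0),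
                   fock_basis_neq0 alpha nu_gt0 n (0 +i* 0)).
  have q1 := fock_basis_neq0 alpha nu_gt0 n (x +i* 0).
  move=> /(congr1 (fun u => u * psi m (0 +i* 0) / psi n (x +i* 0))).
  rewrite divfK// => ->; field; exact/andP.
rewrite mean01Z ?mean_fchar ?subr_eq0; last exact: ccontinuous_fchar.
case: eqVneq => [->|_]; rewrite ?mulr0// mulr1 divff//.
exact: fock_basis_neq0.
Qed.

(** The expansion in the [psi n] is the Fourier series of [f / psi 0]. *)
Lemma fock_expansion f z : fock nu alpha f ->
  clim (fun N => \sum_(n <- zwindow N) fock_dot nu f (psi n) * psi n z) (f z).
Proof.
case: z => x0 y Hf; have [ef qf _] := Hf.
have p0 x := fock_basis_neq0 alpha nu_gt0 0 (x +i* y).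
have := climZ (psi 0 (x0 +i* y)) (fourier_expansion x0 y
  (@fock_quotient_entire f 0 ef) (fock_quotient_periodic 0 qf)).
rewrite mulrCA divff// mulr1; congr (clim _ _); apply/funext => N.
rewrite mulr_sumr; apply: eq_bigr => n _.
have cq := entire_line_x y (@fock_quotient_entire f n ef).
have cq0 : ccontinuous (fun x => f (x +i* y) / psi 0 (x +i* y) * fchar n (x0 - x)).
  apply: ccontinuousM; first exact: (entire_line_x y (@fock_quotient_entire f 0 ef)).
  exact: ccontinuous_fchar_shift.
rewrite (fock_dot_basis n y Hf) [RHS]mulrC -(mean01Z _ cq) -(mean01Z _ cq0).
congr mean01; apply/funext => x.
have := fock_basis_shift 0 n x0 x y; rewrite subr0 => h.
rewrite [RHS]mulrCA [X in _ = _ * X](h); field.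
exact: p0.
Qed.

End ThetaCoefficients.

(** * Bounds, completeness and the reproducing kernel *)

Section FockTheorem.
Context {R : realType}.
Variables (nu alpha : R).
Hypothesis nu_gt0 : 0 < nu.
Local Notation psi := (fock_basis nu alpha).
Local Notation H := (fock nu alpha).
Local Notation dot := (fock_dot nu).
Local Notation K := (fock_kernel nu alpha).
Implicit Types (f g : R[i] -> R[i]) (z w : R[i]) (N : nat).

Let sip : semi_inner_product H dot := fock_sip nu alpha.

Let Hpsi n : H (psi n). Proof. exact: fock_basis_in_fock. Qed.

Let psi_orthonormal m n : dot (psi m) (psi n) = (m == n)%:R.
Proof. exact: fock_basis_orthonormal. Qed.

Definition fock_sum (b : int -> R[i]) (s : seq int) : R[i] -> R[i] :=
  \sum_(n <- s) b n *: psi n.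

Lemma fock_sum_in_fock b s : H (fock_sum b s).
Proof. by apply: (sip_mem_sum sip) => n; exact: (sip_memZ sip). Qed.

Lemma fock_sumE b s z : fock_sum b s z = \sum_(n <- s) b n * psi n z.
Proof. by rewrite /fock_sum fct_sumE. Qed.

Lemma dot_fock_sum f b s : H f ->
  dot f (fock_sum b s) = \sum_(n <- s) ((b n)^*)%C * dot f (psi n).
Proof.
move=> Hf; rewrite (sipC sip (fock_sum_in_fock b s) Hf) (sip_suml sip)//.
rewrite raddf_sum; apply: eq_bigr => n _ /=.
by rewrite conjcM -(sipC sip).
Qed.

(** [fock_expansion] read as inner products with the partial sums of the kernel. *)
Lemma fock_eval_cvg f z : H f ->
  clim (fun N => dot f (fock_sum (fun n => ((psi n z)^*)%C) (zwindow N))) (f z).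
Proof.
move=> Hf; have := fock_expansion nu_gt0 z Hf; congr (clim _ _); apply/funext => N.
by rewrite dot_fock_sum//; apply: eq_bigr => n _; rewrite conjcK mulrC.
Qed.

(** The partial sums of [K z z] are nondecreasing sums of squares, so their limit
is real and bounds them. *)
Lemma fock_kernel_diag z : K z z = (normc (K z z))%:C /\
  forall N, \sum_(n <- zwindow N) normc (psi n z) ^+ 2 <= normc (K z z).
Proof.
have := clim_fock_kernel alpha nu_gt0 z z.
pose s N : R := \sum_(n <- zwindow N) normc (psi n z) ^+ 2.
have sE N : \sum_(n <- zwindow N) ((psi n z)^*)%C * psi n z = (s N)%:C.
  by rewrite /s rmorph_sum/=; apply: eq_bigr => n _; rewrite mulrC mul_conjc.
under eq_fun do rewrite sE; move=> cK.
have s0 N : 0 <= s N by apply: sumr_ge0 => n _; exact: sqr_ge0.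
have := clim_norm cK; under eq_fun do rewrite normc_real ger0_norm//.
move=> sK; split.
  apply: (clim_unique cK); rewrite /clim.
  under eq_fun do rewrite -realcN -realcD normc_real.
  by rewrite -(normr0 R); apply: cvg_norm; apply/subr_cvg0.
move=> N; rewrite -(cvg_lim _ sK)//; apply: (@nondecreasing_cvgn_le _ s).
  apply/nondecreasing_seqP => k; rewrite -subr_ge0 sub_zwindow//.
  by apply: sumr_ge0 => n _; exact: sqr_ge0.
by apply/cvg_ex; exists (normc (K z z)).
Qed.

Lemma fock_bound f z : H f -> normc (f z) <= fock_norm nu f * Num.sqrt (normc (K z z)).
Proof.
move=> Hf; apply: clim_norm_le (fock_eval_cvg z Hf) _ => N.
apply: (le_trans (sip_CauchySchwarz sip Hf (fock_sum_in_fock _ _))).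
rewrite fock_norm_dot ler_wpM2l ?sqrtr_ge0// -[leLHS]ger0_norm ?dot_norm_ge0//.
rewrite -sqrtr_sqr ler_wsqrtr// (sip_norm_sum sip Hpsi psi_orthonormal)//; last first.
  exact: zwindow_uniq.
under eq_bigr do rewrite normc_conj; exact: (fock_kernel_diag z).2.
Qed.

Lemma fock_coef_le f n : H f -> normc (dot f (psi n)) <= fock_norm nu f.
Proof.
move=> Hf; have := sip_CauchySchwarz sip Hf (Hpsi n).
rewrite [X in _ <= _ * X]/dot_norm psi_orthonormal eqxx /= sqrtr1 mulr1.
by rewrite fock_norm_dot.
Qed.

Lemma fock_locally_bounded (r : R) : 0 <= r -> exists C, 0 <= C /\
  forall z f, normc z <= r -> H f -> normc (f z) <= C * fock_norm nu f.
Proof.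
move=> r0; have [C [C0 CP]] := normc_fock_basis_dom alpha nu_gt0 r0.
exists (C * 4); split; first exact: mulr_ge0.
move=> z f zr Hf; apply: clim_norm_le (fock_expansion nu_gt0 z Hf) _ => N.
rewrite (le_trans (normc_sum _ _))//.
apply: (le_trans (y := \sum_(n <- zwindow N) fock_norm nu f * (C * 2^-1 ^+ `|n|))).
  apply: ler_sum => n _; rewrite normcM ler_pM ?normc_ge0//; last exact: CP.
  exact: fock_coef_le.
rewrite -!mulr_sumr [leRHS]mulrC ler_wpM2l ?sqrtr_ge0// ler_wpM2l//.
exact: sum_zwindow_half_le.
Qed.

(** The expansion of [f] inherits the remainder bounds of the [psi n], weighted by
coefficients that are at most the norm of [f]. *)
Lemma fock_quad_diff z : exists C, 0 <= C /\ forall f, H f ->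
  quad_diff (C * fock_norm nu f) f z.
Proof.
have [kappa [C kP]] := fock_basis_quad_diff alpha nu_gt0 z.
have k0 n : 0 <= kappa n.
  have [[D /(_ 1)]] := kP n; rewrite normc1 lexx expr1n !mulr1 => /(_ isT) h _.
  by rewrite (le_trans (normc_ge0 _) h).
have C0 : 0 <= C.
  by have [_] := kP 0; rewrite expr0 mulr1; apply: le_trans.
exists (C * 4); split=> [|f Hf]; first exact: mulr_ge0.
apply: (quad_diff_lim (F := fun N w => \sum_(n <- zwindow N) dot f (psi n) * psi n w)).
  move=> N; apply: (quad_diff_le (C := \sum_(n <- zwindow N)
     normc (dot f (psi n)) * kappa n)).
    apply: (le_trans (y := \sum_(n <- zwindow N) fock_norm nu f * (C * 2^-1 ^+ `|n|))).
      apply: ler_sum => n _; rewrite ler_pM ?normc_ge0//; last by have [] := kP n.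
      exact: fock_coef_le.
    rewrite -!mulr_sumr [leRHS]mulrC ler_wpM2l ?sqrtr_ge0// ler_wpM2l//.
    exact: sum_zwindow_half_le.
  apply: (@quad_diff_sum _ _ _ _ (fun n w => dot f (psi n) * psi n w)) => n.
  by apply: quad_diffZ; have [] := kP n.
by move=> w; exact: fock_expansion.
Qed.

Lemma fock_inner_product : inner_product_on H dot.
Proof.
have [_ s1 s2 s3] := sip; split=> // f Hf f0; apply/funext => z.
apply/normc_eq0P/eqP; rewrite eq_le normc_ge0 andbT.
have := fock_bound z Hf; rewrite -fock_norm_dot /dot_norm f0 /= sqrtr0 mul0r.
exact.
Qed.

Lemma fock_sqnorm_norm f : H f -> fock_sqnorm nu f = (fock_norm nu f ^+ 2)%:E.
Proof.
move=> [ef qf nf]; have n0 : (0 <= fock_sqnorm nu f)%E.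
  by rewrite fock_sqnormE; apply: integral_ge0 => p _; rewrite lee_fin sqr_ge0.
by rewrite /fock_norm sqr_sqrtr ?fine_ge0// fineK// ge0_fin_numE.
Qed.

Lemma fock_sqnorm_Fatou (v : nat -> R[i] -> R[i]) f (M : R) :
  (forall k, entire (v k)) -> (forall z, clim (v^~ z) (f z)) ->
  (forall k, (fock_sqnorm nu (v k) <= M%:E)%E) -> (fock_sqnorm nu f <= M%:E)%E.
Proof.
move=> ev vf vM.
have mv k : measurable_fun strip (fun p => (normc (weighted nu (v k) p) ^+ 2)%:E).
  by apply/measurable_EFinP; apply: cmeasurable_normc; exact: weighted_measurable.
have pos k (p : measurableTypeR R * measurableTypeR R) : strip p ->
    (0 <= (normc (weighted nu (v k) p) ^+ 2)%:E)%E.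
  by move=> _; rewrite lee_fin sqr_ge0.
have := fatou lebesgue2 (@measurable_strip R) mv pos.
rewrite fock_sqnormE (eq_integral (fun p => (normc (weighted nu f p) ^+ 2)%:E));
    last first.
  move=> p _; apply: (cvg_limn_einf_sup _).1.
  have cvn : (fun k => normc (weighted nu (v k) p)) @ \oo --> normc (weighted nu f p).
    apply: clim_norm; set e := (expR (- nu / 2 * (p.1 ^+ 2 + p.2 ^+ 2)))%:C.
    have := climZ e (vf (p.1 +i* p.2)); rewrite mulrC; congr (clim _ _).
    by apply/funext => k; rewrite mulrC.
  apply: cvg_EFin; first by apply: nearW.
  by under eq_fun do rewrite /= expr2; rewrite expr2; exact: cvgM.
move=> h; apply: (le_trans h); rewrite limn_einf_lim; apply: lime_le.
  exact: is_cvg_einfs.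
apply: nearW => k; apply: (le_trans _ (vM k)); rewrite fock_sqnormE.
by apply: ereal_inf_lbound; exists k => /=.
Qed.

Lemma dot_normB f g : H f -> H g -> dot_norm dot (f - g) = dot_norm dot (g - f).
Proof.
move=> Hf Hg; have Hgf : H (g - f) by exact: (sip_memB sip).
have -> : f - g = (-1) *: (g - f) by rewrite scaleN1r opprB.
rewrite /dot_norm (sipZl sip)//; last exact: (sip_memZ sip).
rewrite (sipZr sip)// mulrA conjcN conjc1 mulrNN mulr1 mul1r//.
Qed.

(** A Cauchy sequence converges pointwise by [fock_locally_bounded]; the limit is
entire by [fock_quad_diff] and lies in the space by Fatou's lemma. *)
Lemma fock_complete : complete_on H dot.
Proof.
move=> u Hu uC.
have Cnorm (e : R) : 0 < e -> exists N, forall m n : nat, (N <= m)%N -> (N <= n)%N ->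
    fock_norm nu (u m - u n) <= e.
  by move=> /uC[N NP]; exists N => m n Nm Nn; rewrite -fock_norm_dot ltW ?NP.
have Hsub (m n : nat) : H (u m - u n) by exact: (sip_memB sip).
have lim_u z : exists y, clim (u^~ z) y.
  apply: clim_cauchy => e e0.
  have [C [C0 CP]] := fock_locally_bounded (normc_ge0 z).
  have [N NP] := Cnorm (e / (C + 1)) (divr_gt0 e0 (ltr_wpDl C0 ltr01)).
  exists N => m n Nm Nn; have := CP z _ (lexx _) (Hsub m n).
  move=> /le_trans; apply; have := NP m n Nm Nn; rewrite ler_pdivlMr ?ltr_wpDl//.
  have : 0 <= fock_norm nu (u m - u n) by exact: sqrtr_ge0.
  lra.
have [l ul] := choice lim_u.
have dl N z : clim (fun m => (u m - u N) z) ((l - u N) z).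
  by apply: climB => //; exact: clim_cst.
(* Subtracting [u N1] keeps the norms, hence the remainder constants, bounded. *)
have [N1 N1P] := Cnorm 1 ltr01.
have el1 : entire (l - u N1).
  move=> z; have [C [C0 CP]] := fock_quad_diff z.
  apply: (@quad_diff_derivable _ C).
  apply: (@quad_diff_lim _ C (fun k => u (k + N1)%N - u N1)).
    move=> k; apply: quad_diff_le (CP _ (Hsub _ _)).
    by rewrite ler_piMr// N1P// leq_addl.
  move=> w; have /clim_epsP h := dl N1 w; apply/clim_epsP => e /h[N NP].
  by exists N => n Nn; apply: NP; rewrite (leq_trans Nn)// leq_addr.
have eu N : entire (u N) by have [] := Hu N.
have el : entire l.
  have -> : l = (fun z => (l - u N1) z + u N1 z) by apply/funext => z; rewrite /= subrK.
  exact: (@entireD _ (l - u N1) (u N1) el1 (eu N1)).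
have lsq (e : R) : 0 < e -> exists N, forall n : nat, (N <= n)%N ->
    (fock_sqnorm nu (u n - l)%R <= (e ^+ 2)%:E)%E.
  move=> e0; have [N NP] := Cnorm e e0; exists N => n Nn.
  apply: (@fock_sqnorm_Fatou (fun k => u n - u (k + N)%N)).
  - move=> k; exact: (@entireB _ (u n) (u (k + N)%N) (eu _) (eu _)).
  - move=> z; apply: climB; first exact: clim_cst.
    have /clim_epsP h := ul z; apply/clim_epsP => d /h[N' N'P].
    by exists N' => k Nk; apply: N'P; rewrite (leq_trans Nk)// leq_addr.
  - move=> k; rewrite fock_sqnorm_norm// lee_fin ler_pXn2r ?nnegrE ?sqrtr_ge0//.
      by apply: NP => //; exact: leq_addl.
    exact: ltW.
have eul (n : nat) : entire (u n - l) by exact: (@entireB _ (u n) l (eu n) el).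
have Hl : H l.
  split=> //.
    move=> z m; have [_ q _] := Hu 0%N.
    apply: (clim_unique (ul _)).
    under eq_fun => k do (have [_ qk _] := Hu k; rewrite qk).
    exact: climZ.
  have [N NP] := lsq 1 ltr01.
  have -> : l = (-1) *: (u N - l) + u N by rewrite scaleN1r opprB subrK.
  apply: fock_sqnormZD_lty; [exact: eul|exact: eu| |by have [] := Hu N].
  by rewrite (le_lt_trans (NP N (leqnn _)))// ltry.
exists l => //.
apply/cvgrPdist_le => e e0; have [N NP] := lsq e e0; exists N => // n /= Nn.
rewrite sub0r normrN ger0_norm ?dot_norm_ge0// fock_norm_dot.
have := NP n Nn; rewrite fock_sqnorm_norm; last exact: (sip_memB sip).
by rewrite lee_fin ler_pXn2r ?nnegrE ?sqrtr_ge0// ltW.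
Qed.

(** Square-summability makes the partial sums Cauchy; their limit in norm is also
their pointwise limit, hence [F]. *)
Lemma fock_sum_cvg (b : int -> R[i]) (B : R) F :
  (forall N, \sum_(n <- zwindow N) normc (b n) ^+ 2 <= B) ->
  (forall z, clim (fun N => fock_sum b (zwindow N) z) (F z)) ->
  H F /\ (fun N => dot_norm dot (fock_sum b (zwindow N) - F)) @ \oo --> (0 : R).
Proof.
move=> bB bF; pose s N : R := \sum_(n <- zwindow N) normc (b n) ^+ 2.
have sdiff (m n : nat) : (m <= n)%N ->
    dot_norm dot (fock_sum b (zwindow n) - fock_sum b (zwindow m)) ^+ 2 = s n - s m.
  move=> mn; rewrite /fock_sum sub_zwindow// /s sub_zwindow//.
  by apply: (sip_norm_sum sip) => //; exact: zannulus_uniq.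
have sinc : nondecreasing_seq s.
  by apply/nondecreasing_seqP => n; rewrite -subr_ge0 -sdiff// sqr_ge0.
have scv : cvgn s.
  by apply: nondecreasing_is_cvgn => //; exists B => _ [N _ <-]; exact: bB.
have Hs N := fock_sum_in_fock b (zwindow N).
have [|l Hl lP] := fock_complete (u := fun N => fock_sum b (zwindow N)) Hs.
  move=> e e0; have e2 : 0 < e ^+ 2 by rewrite exprn_gt0.
  have /cvgrPdist_lt/(_ _ e2)[N _ NP] := scv.
  have key (m n : nat) : (N <= m)%N -> (m <= n)%N ->
      dot_norm dot (fock_sum b (zwindow n) - fock_sum b (zwindow m)) < e.
    move=> Nm mn; rewrite -(ltr_pXn2r (_ : 0 < 2)%N) ?nnegrE ?dot_norm_ge0 ?ltW//.
    rewrite sdiff//; have := NP m Nm; rewrite /= ger0_norm ?subr_ge0; last first.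
      exact: nondecreasing_cvgn_le.
    by have := nondecreasing_cvgn_le sinc scv n; lra.
  exists N => m n Nm Nn; have [mn|/ltnW nm] := leqP m n; last exact: key.
  by rewrite dot_normB// key.
suff -> : F = l by [].
apply/funext => z; apply: (clim_unique (bF z)).
have [C [C0 CP]] := fock_locally_bounded (normc_ge0 z).
apply: (clim_squeeze (e := fun N => C * dot_norm dot (fock_sum b (zwindow N) - l))).
  move=> N; rewrite fock_norm_dot.
  by apply: (CP z _ (lexx _)); exact: (sip_memB sip).
by rewrite -(mulr0 C); apply: cvgM => //; exact: cvg_cst.
Qed.

Lemma fock_orthonormal_basis : orthonormal_basis H dot psi.
Proof.
split=> // f Hf e e0.
have [||_ /cvgrPdist_lt/(_ _ e0)[N _ NP]] :=
  @fock_sum_cvg (fun n => dot f (psi n)) (dot_norm dot f ^+ 2) f.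
- by move=> N; apply: (sip_Bessel sip Hpsi psi_orthonormal) => //; exact: zwindow_uniq.
- move=> z; have := fock_expansion nu_gt0 z Hf; congr (clim _ _).
  by apply/funext => N; rewrite fock_sumE.
exists (zwindow N), (fun n => dot f (psi n)).
have := NP N (leqnn N); rewrite /= sub0r normrN ger0_norm ?dot_norm_ge0//.
by rewrite dot_normB//; exact: fock_sum_in_fock.
Qed.

Lemma fock_reproducing_kernel : reproducing_kernel H dot K.
Proof.
move=> w.
have [||HK KP] := @fock_sum_cvg (fun n => ((psi n w)^*)%C) (normc (K w w)) (K^~ w).
- by move=> N; under eq_bigr do rewrite normc_conj; exact: (fock_kernel_diag w).2.
- move=> z; have := clim_fock_kernel alpha nu_gt0 z w; congr (clim _ _).
  by apply/funext => N; rewrite fock_sumE.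
split=> // f Hf; apply: (clim_unique (fock_eval_cvg w Hf)).
apply: (clim_squeeze (e := fun N => dot_norm dot f *
   dot_norm dot (fock_sum (fun n => ((psi n w)^*)%C) (zwindow N) - K^~ w))).
  move=> N; have Hs := fock_sum_in_fock (fun n => ((psi n w)^*)%C) (zwindow N).
  rewrite -(sipBr sip)//; apply: (sip_CauchySchwarz sip) => //.
  exact: (sip_memB sip).
by rewrite -(mulr0 (dot_norm dot f)); apply: cvgM => //; exact: cvg_cst.
Qed.

Lemma compact_normc_bounded (A : set R[i]^o) : compact A ->
  exists2 r : R, 0 <= r & forall z, A z -> normc z <= r.
Proof.
move=> cA; have cn : continuous (fun z : R[i]^o => normc z : R).
  move=> z B /nbhs_ballP[e e0 eB]; apply/nbhs_ballP.
  exists e%:C; first by rewrite /= ltcR.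
  move=> w; rewrite -ball_normE /=; rewrite normrc ltcR => zw; apply: eB.
  exact: (le_lt_trans (ler_dist_normc _ _) zw).
have := continuous_compact (continuous_subspaceT cn) cA.
move=> /compact_bounded[M [_ MP]]; exists (`|M| + 1); first by rewrite addr_ge0.
move=> z Az; rewrite -[leLHS]ger0_norm ?normc_ge0//.
by apply: MP; [rewrite (le_lt_trans (ler_norm _))// ltrDl|exists z].
Qed.

End FockTheorem.

Theorem theorem2p5 (R : realType) (nu alpha : R) (nu_gt0 : 0 < nu) :
  ((forall (f : R[i] -> R[i]) (z : R[i]), fock nu alpha f ->
      `|f z| <=
      (fock_norm nu f)%:C
      * sqrtC (((2 * nu / pi) `^ 2^-1)%:C
               * cexp ((nu / 2)%:C * (z ^+ 2 + (z^*)%C ^+ 2))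
               * theta alpha 0 (z - (z^*)%C) (2 * 'i%C * pi%:C / nu%:C)))
   /\
   (forall K : set R[i]^o, compact K ->
      exists C_K : R, 0 <= C_K /\
        forall (z : R[i]) (f : R[i] -> R[i]), K z -> fock nu alpha f ->
          `|f z| <= (C_K * fock_norm nu f)%:C))
  /\
  ((forall f g : R[i] -> R[i], fock nu alpha f -> fock nu alpha g ->
      strip_integrable (fock_integrand nu f g))
   /\ hilbert_space (fock nu alpha) (fock_dot nu)
   /\ orthonormal_basis (fock nu alpha) (fock_dot nu) (fock_basis nu alpha))
  /\
  reproducing_kernel (fock nu alpha) (fock_dot nu) (fock_kernel nu alpha).
Proof.
split; [split|split; [split; [|split]|]].
- move=> f z Hf; rewrite -/(fock_kernel nu alpha z z).
  rewrite (fock_kernel_diag alpha nu_gt0 z).1; set k := normc _.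
  have -> : k%:C = (Num.sqrt k)%:C ^+ 2 by rewrite -realcX sqr_sqrtr// normc_ge0.
  rewrite sqrCK ?lecR ?sqrtr_ge0// -realcM normrc lecR.
  exact: fock_bound.
- move=> K /compact_normc_bounded[r r0 rP].
  have [C [C0 CP]] := fock_locally_bounded alpha nu_gt0 r0.
  exists C; split=> // z f /rP zr Hf; rewrite normrc lecR; exact: CP.
- exact: fock_strip_integrable.
- split; [exact: fock_linear_subspace|exact: fock_inner_product|].
  exact: fock_complete.
- exact: fock_orthonormal_basis.
- exact: fock_reproducing_kernel.
Qed.
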